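(* Let $\alpha>0$ and let $n\ge 2$ be an integer. Then $$\sup_{u\in W^{1,n}_{0,\mathrm{rad}}(B):\ \int_B|\nabla u|^n\,dx\le 1}\ \int_B \exp\big((\alpha_n+|x|^\alpha)\,|u|^{\frac{n}{n-1}}\big)\,dx<+\infty$$ and $$\sup_{u\in W^{1,n}_{0,\mathrm{rad}}(B):\ \int_B|\nabla u|^n\,dx\le 1}\ \int_B \exp\big(\alpha_n\,|u|^{\frac{n}{n-1}+|x|^\alpha}\big)\,dx<+\infty,$$ where $\alpha_n=n\,\omega_{n-1}^{1/(n-1)}$.
   Context: $B$ is the unit ball of $\mathbb R^n$ centered at the origin. $\omega_{n-1}$ is the surface measure of the unit sphere $\mathbb S^{n-1}\subset\mathbb R^n$. $W^{1,n}_{0,\mathrm{rad}}(B)$ is the subspace of $W^{1,n}_0(B)$ consisting of functions radially symmetric about the origin; equivalently, the completion of the compactly supported smooth radial functions on $B$ under the norm $\big(\int_B|\nabla u|^n\,dx\big)^{1/n}$. *)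

(* Defs.v *)
From HB Require Import structures.
From mathcomp Require Import all_boot all_order all_algebra.
From mathcomp Require Import all_classical all_reals all_analysis.
Import Order.TTheory GRing.Theory Num.Theory.
Import numFieldNormedType.Exports.

Set Implicit Arguments.
Unset Strict Implicit.
Unset Printing Implicit Defensive.

Local Open Scope classical_set_scope.
Local Open Scope ring_scope.

(* 'rV[R]_n carries the product sigma-algebra, generated by the coordinate
   maps; it is the Borel sigma-algebra of R^n. *)

Definition rV_coord (R : realType) (n : nat) (i : 'I_n) (x : 'rV[R]_n) :
  measurableTypeR R := x 0 i.

Definition rV_measurable (R : realType) (n : nat) : set (set 'rV[R]_n) :=
  g_sigma_preimage (@rV_coord R n).

Lemma rV_measurable0 (R : realType) (n : nat) : @rV_measurable R n set0.
Proof. exact: sigma_algebra0. Qed.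

Lemma rV_measurableC (R : realType) (n : nat) (A : set 'rV[R]_n) :
  rV_measurable A -> rV_measurable (~` A).
Proof. exact: sigma_algebraC. Qed.

Lemma rV_measurable_bigcup (R : realType) (n : nat) (F : (set 'rV[R]_n)^nat) :
  (forall k, rV_measurable (F k)) -> rV_measurable (\bigcup_k F k).
Proof. exact: sigma_algebra_bigcup. Qed.

Definition rV_display : measure_display.
Proof. exact: default_measure_display. Qed.

HB.instance Definition _ (R : realType) (n : nat) :=
  @isMeasurable.Build rV_display 'rV[R]_n (@rV_measurable R n)
    (@rV_measurable0 R n) (@rV_measurableC R n) (@rV_measurable_bigcup R n).

Lemma measurable_rV_coord (R : realType) (n : nat) (i : 'I_n) :
  measurable_fun [set: 'rV[R]_n] (@rV_coord R n i).
Proof.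
move=> _ Y mY; rewrite setTI; apply: sub_sigma_algebra => /=.
rewrite -bigcup_seq/=; exists i => /=; first by rewrite mem_index_enum.
by exists Y => //; rewrite setTI.
Qed.

Lemma measurable_fun_rVP d (T : measurableType d) (R : realType) (n : nat)
    (f : T -> 'rV[R]_n) :
  measurable_fun [set: T] f <->
  forall i, measurable_fun [set: T] (rV_coord i \o f).
Proof.
split=> [mf i|mf].
  exact: measurableT_comp (measurable_rV_coord i) mf.
move=> _ A; apply: (@measurability _ _ _ _ _ f (\big[setU/set0]_(i < n)
  preimage_set_system setT (@rV_coord R n i) measurable)) => //.
move=> _ [B + <-].
rewrite -bigcup_seq => -[i _ [C mC <-]].
by rewrite setTI; apply: mf.
Qed.

Definition rV_cons (R : realType) (n : nat)
    (p : measurableTypeR R * 'rV[R]_n) : 'rV[R]_n.+1 :=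
  \row_i oapp (p.2 0) p.1 (unlift ord0 i).

Definition rV_uncons (R : realType) (n : nat) (x : 'rV[R]_n.+1) :
  measurableTypeR R * 'rV[R]_n := (x 0 ord0, \row_i x 0 (lift ord0 i)).

Lemma rV_consK (R : realType) (n : nat) :
  cancel (@rV_cons R n) (@rV_uncons R n).
Proof.
move=> [t v]; rewrite /rV_uncons /rV_cons; congr pair.
  by rewrite mxE unlift_none.
by apply/rowP => i; rewrite !mxE liftK.
Qed.

Lemma measurable_rV_cons (R : realType) (n : nat) :
  measurable_fun [set: measurableTypeR R * 'rV[R]_n] (@rV_cons R n).
Proof.
apply/measurable_fun_rVP => i.
case: (unliftP ord0 i) => [j ->|->].
- rewrite (_ : _ \o _ = rV_coord j \o snd); last first.
    by apply/funext => p; rewrite /= /rV_coord mxE liftK.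
  exact: measurableT_comp (measurable_rV_coord j) measurable_snd.
- rewrite (_ : _ \o _ = fst)//.
  by apply/funext => p; rewrite /= /rV_coord mxE unlift_none.
Qed.

Lemma measurable_rV_uncons (R : realType) (n : nat) :
  measurable_fun [set: 'rV[R]_n.+1] (@rV_uncons R n).
Proof.
apply/measurable_fun_pairP; split => /=; first exact: measurable_rV_coord.
apply/measurable_fun_rVP => i.
rewrite (_ : _ \o _ = rV_coord (lift ord0 i)).
  exact: measurable_rV_coord.
by apply/funext => x; rewrite /= /rV_coord mxE.
Qed.

(* The product of Lebesgue measure on R with a measure mu on R^n, carried to
   R^(n+1). *)
Definition lebesgue_cons (R : realType) (n : nat)
    (mu : set 'rV[R]_n -> \bar R) : set 'rV[R]_n.+1 -> \bar R :=
  pushforward (lebesgue_measure \x mu)%E (@rV_cons R n).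

Section lebesgue_cons_measure.
Variables (R : realType) (n : nat).
Variable mu : {sigma_finite_measure set 'rV[R]_n -> \bar R}.

Let lam := lebesgue_cons mu.

Let lam0 : lam set0 = 0%E.
Proof. by rewrite /lam /lebesgue_cons /pushforward preimage_set0 measure0. Qed.

Let lam_ge0 A : (0 <= lam A)%E.
Proof. by rewrite /lam /lebesgue_cons /pushforward measure_ge0. Qed.

Let lam_sigma_additive : semi_sigma_additive lam.
Proof.
move=> F mF tF mUF; rewrite /lam /lebesgue_cons /pushforward preimage_bigcup.
apply: measure_semi_sigma_additive.
- by move=> k; rewrite -[X in measurable X]setTI; apply: measurable_rV_cons.
- apply/trivIsetP => /= i j _ _ ij; rewrite -preimage_setI.
  by move/trivIsetP : tF => /(_ _ _ _ _ ij) ->//; rewrite preimage_set0.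
- rewrite -preimage_bigcup -[X in measurable X]setTI.
  exact: measurable_rV_cons.
Qed.

HB.instance Definition _ := isMeasure.Build _ _ _ lam
  lam0 lam_ge0 lam_sigma_additive.

Let lam_sigma_finite : sigma_finite setT lam.
Proof.
have [F TF Foo] : sigma_finite setT (@lebesgue_measure R \x mu)%E.
  have /sigma_finiteP[F [TF ndF Foo]] := sigma_finiteT (@lebesgue_measure R).
  have /sigma_finiteP[G [TG ndG Goo]] := sigma_finiteT mu.
  exists (fun k => F k `*` G k).
    rewrite -setXTT TF TG predeqE => -[x y]; split.
      move=> [/= [i _ Fx] [j _ Gy]]; exists (maxn i j) => //; split.
      - by move: x Fx; exact/subsetPset/ndF/leq_maxl.
      - by move: y Gy; exact/subsetPset/ndG/leq_maxr.
    by move=> [i _ []/= ? ?]; split; exists i.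
  move=> k; have [? ?] := Foo k; have [? ?] := Goo k.
  split; first exact: measurableX.
  by rewrite product_measure1E// lte_mul_pinfty// ge0_fin_numE.
exists (fun k => @rV_uncons R n @^-1` F k).
  by rewrite -preimage_bigcup -TF preimage_setT.
move=> k; have [mF Fk] := Foo k; split.
  by rewrite -[X in measurable X]setTI; apply: measurable_rV_uncons.
rewrite /lam /lebesgue_cons /pushforward -comp_preimage.
rewrite (_ : _ \o _ = id) ?preimage_id//.
by apply/funext => p /=; rewrite rV_consK.
Qed.

HB.instance Definition _ := Measure_isSigmaFinite.Build _ _ _ lam
  lam_sigma_finite.

Definition lebesgue_cons_measure :
  {sigma_finite_measure set 'rV[R]_n.+1 -> \bar R} := lam.

End lebesgue_cons_measure.

Fixpoint lebesgue_rV (R : realType) (n : nat) :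
    {sigma_finite_measure set 'rV[R]_n -> \bar R} :=
  if n is m.+1 then lebesgue_cons_measure (lebesgue_rV R m)
  else [the {sigma_finite_measure set 'rV[R]_0 -> \bar R} of \d_(0 : 'rV[R]_0)].

Lemma lebesgue_rV_box (R : realType) (n : nat) (A : 'I_n -> set (measurableTypeR R)) :
  (forall i, measurable (A i)) ->
  lebesgue_rV R n [set x | forall i, A i (x 0 i)] =
  (\prod_i lebesgue_measure (A i))%E.
Proof.
elim: n A => [|n IH] A mA.
  rewrite big_ord0 /= diracE mem_set//= => -[]//.
rewrite big_ord_recl -IH//= /lebesgue_cons /pushforward.
have mB : measurable [set x : 'rV[R]_n | forall i, A (lift ord0 i) (x 0 i)].
  rewrite (_ : mkset _ = \big[setI/setT]_(i < n) (@rV_coord R n i @^-1` A (lift ord0 i))).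
    apply: bigsetI_measurable => i _; rewrite -[X in measurable X]setTI.
    exact: measurable_rV_coord.
  rewrite -bigcap_seq; apply/seteqP; split=> x /= H i; first by move=> _; exact: H.
  by apply: (H i); rewrite /= mem_index_enum.
rewrite -product_measure1E//; congr (_ \x _)%E; apply/seteqP; split=> -[t v] /=.
  move=> H; split=> [|i].
    by have := H ord0; rewrite mxE unlift_none.
  by have := H (lift ord0 i); rewrite mxE liftK.
move=> [Ht Hv] i; rewrite mxE; case: unliftP => [j|] -> //=.
Qed.

Definition enorm (R : realType) (n : nat) (x : 'rV[R]_n) : R :=
  Num.sqrt (\sum_i x 0 i ^+ 2).

Definition unit_ball (R : realType) (n : nat) : set 'rV[R]_n :=
  [set x | enorm x < 1].

Lemma measurable_unit_ball (R : realType) (n : nat) : measurable (@unit_ball R n).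
Proof.
have mf : measurable_fun [set: 'rV[R]_n] 
    (fun x => \sum_i (rV_coord i x : measurableTypeR R) ^+ 2 : measurableTypeR R).
  apply: measurable_sum => i; apply: measurable_realfun.measurable_funX; exact: measurable_rV_coord.
rewrite (_ : @unit_ball R n = [set: 'rV[R]_n] `&`
    (fun x => \sum_i (rV_coord i x : R) ^+ 2) @^-1` [set` `]-oo, (1:R)[]).
  by apply: mf => //; exact: measurable_itv.
apply/seteqP; split=> x /=; rewrite /unit_ball /= /enorm ?setTI /= in_itv /=.
  by rewrite -[X in _ < X]sqrtr1 ltr_sqrt// => h; split.
by move=> [_ h]; rewrite -[X in _ < X]sqrtr1 ltr_sqrt.
Qed.

Definition unit_sphere (R : realType) (n : nat) : set 'rV[R]_n :=
  [set x | enorm x = 1].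

Definition cone (R : realType) (n : nat) (A : set 'rV[R]_n) : set 'rV[R]_n :=
  [set x | exists r : R, exists2 y, A y & 0 < r <= 1 /\ x = r *: y].

(* Surface measure on the unit sphere of R^n, by polar coordinates: the
   measure of A is n times the volume of the cone over A with apex 0. *)
Definition sphere_measure (R : realType) (n : nat) (A : set 'rV[R]_n) : \bar R :=
  (n%:R%:E * lebesgue_rV R n (cone A))%E.

(* omega n is the total surface measure of the unit sphere of R^n; it is
   written omega_(n-1) in the usual notation. *)
Definition omega (R : realType) (n : nat) : R :=
  fine (sphere_measure (@unit_sphere R n)).

Definition alpha_crit (R : realType) (n : nat) : R :=
  n%:R * omega R n `^ (1 / (n%:R - 1)).

Definition partial (R : realType) (n : nat) (i : 'I_n) (f : 'rV[R]_n -> R) :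
  'rV[R]_n -> R := fun x => 'D_(delta_mx 0 i) f x.

Definition grad (R : realType) (n : nat) (f : 'rV[R]_n -> R) (x : 'rV[R]_n) :
  'rV[R]_n := \row_i partial i f x.

Definition smooth (R : realType) (n : nat) (f : 'rV[R]_n -> R) : Prop :=
  forall s : seq 'I_n, let g := foldr (@partial R n) f s in
    continuous g /\ forall i x, derivable g x (delta_mx 0 i).

(* Functions on U are represented by functions on R^n.  Test functions are
   extended by 0; for all other functions the values off U are irrelevant. *)
Definition test_function (R : realType) (n : nat) (U : set 'rV[R]_n)
    (phi : 'rV[R]_n -> R) : Prop :=
  let supp := closure [set x | phi x != 0] in
  [/\ smooth phi, compact supp & supp `<=` U].

Definition in_Lp (R : realType) (n p : nat) (U : set 'rV[R]_n)
    (f : 'rV[R]_n -> R) : Prop :=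
  measurable_fun U (f : 'rV[R]_n -> measurableTypeR R) /\
  (\int[lebesgue_rV R n]_(x in U) (`|f x| ^+ p)%:E < +oo)%E.

Definition weak_gradient (R : realType) (n : nat) (U : set 'rV[R]_n)
    (u : 'rV[R]_n -> R) (G : 'rV[R]_n -> 'rV[R]_n) : Prop :=
  forall phi, test_function U phi -> forall i : 'I_n,
    \int[lebesgue_rV R n]_(x in U) (u x * partial i phi x) =
    - \int[lebesgue_rV R n]_(x in U) (G x 0 i * phi x).

(* u belongs to W^{1,p}(U) and G is its weak gradient. *)
Definition W1 (R : realType) (n p : nat) (U : set 'rV[R]_n)
    (u : 'rV[R]_n -> R) (G : 'rV[R]_n -> 'rV[R]_n) : Prop :=
  [/\ in_Lp p U u, forall i, in_Lp p U (fun x => G x 0 i)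
    & weak_gradient U u G].

(* u belongs to W^{1,p}_0(U), the closure of the test functions in W^{1,p}(U),
   and G is its weak gradient. *)
Definition W10 (R : realType) (n p : nat) (U : set 'rV[R]_n)
    (u : 'rV[R]_n -> R) (G : 'rV[R]_n -> 'rV[R]_n) : Prop :=
  W1 p U u G /\
  forall e : R, 0 < e -> exists2 phi, test_function U phi &
    (\int[lebesgue_rV R n]_(x in U) (`|u x - phi x| ^+ p)%:E +
     \int[lebesgue_rV R n]_(x in U) (enorm (G x - grad phi x) ^+ p)%:E < e%:E)%E.

(* Elements of W^{1,p}_0(U) are classes modulo a.e. equality, so radial
   symmetry means that u agrees a.e. on U with a function of the norm. *)
Definition radial (R : realType) (n : nat) (U : set 'rV[R]_n)
    (u : 'rV[R]_n -> R) : Prop :=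
  exists g : R -> R, {ae lebesgue_rV R n, forall x, U x -> u x = g (enorm x)}.

Definition W10rad (R : realType) (n p : nat) (U : set 'rV[R]_n)
    (u : 'rV[R]_n -> R) (G : 'rV[R]_n -> 'rV[R]_n) : Prop :=
  W10 p U u G /\ radial U u.

Definition unit_energy (R : realType) (n : nat) : set ('rV[R]_n -> R) :=
  [set u | exists2 G, W10rad n (@unit_ball R n) u G &
    (\int[lebesgue_rV R n]_(x in @unit_ball R n) (enorm (G x) ^+ n)%:E <= 1)%E].

(* Main.v *)
(* Along almost every ray from the origin, test functions converging to u in
   W^{1,n} converge pointwise and with their gradients in L^n(r^(n-1) dr), so
   that |u(r e)| <= int_r^1 |G(t e)| dt.  By polar coordinates some ray carries at
   most the average energy, int_0^1 |G(t e)|^n t^(n-1) dt <= 1 / omega, and since u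
   is radial its values on this single ray determine it.  This reduces both
   inequalities to W(r) = int_r^1 f with int_0^1 f^n r^(n-1) dr <= 1 / omega.
   With T = - n ln r, Hoelder gives alpha_n W^(n/(n-1)) <= T, hence
   |x|^alpha |u|^(n/(n-1)) is bounded, as is the excess produced by the variable
   exponent, and Moser's critical inequality for W remains.  It holds because
   the level set {T - alpha_n W^(n/(n-1)) <= l} is contained in two intervals of
   length O(l) in the variable T: if t1 is in it, all but a fraction O(l / t1) of
   the energy has been spent by t1, so a second point t2 > t1 satisfies
   t2 - t1 = O(l). *)
Require Import Defs.
From mathcomp Require Import all_boot all_order all_algebra.
From mathcomp Require Import all_classical all_reals all_analysis.
From mathcomp Require Import measurable_realfun.
From mathcomp Require Import ring lra.
Import Order.TTheory GRing.Theory Num.Theory.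
Import numFieldNormedType.Exports.
Set Implicit Arguments.
Unset Strict Implicit.
Unset Printing Implicit Defensive.
Local Open Scope classical_set_scope.
Local Open Scope ring_scope.

(** * Scaling of Lebesgue measure *)

Section scaling.
Context {R : realType}.
Local Notation leb := (@lebesgue_measure R).
Local Open Scope ereal_scope.

(** Since surface measure is defined through cones, directions are averaged over the cone itself: a
    point [x] of [punctured_ball] stands for [dir x]. Polar coordinates then need only Tonelli and
    the scaling of Lebesgue measure, and averages are taken over a set of positive finite volume.

    The approximating test functions have summable errors, so a single integrable series controls
    convergence on almost every ray. The null set where radial symmetry fails is handled in the same
    way, by adding +oo on it: a ray with finite integral meets it only at a null set of radii.

    The critical inequality leaves no room. Bounding the exponential by e^T = r^(-n) against r^(n-1)
    dr leaves dr/r, which diverges at 0, so decay must come from the deficit T - alpha_n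
    W^(n/(n-1)). Where the deficit lies between k and k + 1 there is a factor e^(-k), and the length
    in T of this layer grows only linearly in k. The positions of the covering intervals depend on
    the function but their lengths do not, whence a uniform bound. *)

Lemma measurable_scale1 (t : R) :
  measurable_fun setT (fun x : measurableTypeR R => (t * x)%R : measurableTypeR R).
Proof. exact: mulrl_measurable. Qed.

(** Uniqueness of Lebesgue measure: [t] times its pushforward under multiplication by [t] gives
    every half-open interval its length. *)
Lemma lebesgue_measure_scale (t : R) (A : set (measurableTypeR R)) :
  (0 < t)%R -> measurable A ->
  leb ((fun x => t * x)%R @^-1` A) = (t^-1)%:E * leb A.
Proof.
move=> t0 mA.
pose f : measurableTypeR R -> measurableTypeR R := fun x => (t * x)%R.
have mf : measurable_fun setT f := measurable_scale1 t.
pose m := mscale (NngNum (ltW t0)) (pushforward leb f).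
have H : forall X, measurable X -> leb X = m mf X.
  apply: lebesgue_measure_unique => _ [[a b]] _ <-.
  rewrite -[RHS]/(t%:E * leb (f @^-1` [set` `]a, b]])).
  rewrite (_ : f @^-1` _ = [set` `](t^-1 * a)%R, (t^-1 * b)%R]]); last first.
    apply/seteqP; split => x /=; rewrite !in_itv /= /f;
      by rewrite ltr_pdivrMl// ler_pdivlMl.
  rewrite !lebesgue_measure_itv /= !lte_fin ltr_pM2l ?invr_gt0//.
  case: ifP => _; last by rewrite mule0.
  by rewrite -!EFinB -EFinM -mulrBr mulrA divff ?mul1r// gt_eqF.
rewrite [in RHS](H _ mA) -[X in _ = _ * X]/(t%:E * leb (f @^-1` A)) muleA -EFinM mulVf ?mul1e//.
by rewrite gt_eqF.
Qed.

Lemma ge0_integral_scale1 (t : R) (f : measurableTypeR R -> \bar R) :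
  (0 < t)%R -> measurable_fun setT f -> (forall x, 0 <= f x) ->
  \int[leb]_x f (t * x)%R = (t^-1)%:E * \int[leb]_x f x.
Proof.
move=> t0 mf f0.
pose g : measurableTypeR R -> measurableTypeR R := fun x => (t * x)%R.
have mg : measurable_fun setT g := measurable_scale1 t.
transitivity (\int[pushforward leb g]_x f x).
  by rewrite ge0_integral_pushforward// preimage_setT.
have ti : (0 <= t^-1)%R by rewrite invr_ge0 ltW.
transitivity (\int[mscale (NngNum ti) leb]_x f x).
  apply: eq_measure_integral => A mA _.
  by rewrite /= /pushforward lebesgue_measure_scale.
by rewrite ge0_integral_mscale.
Qed.

Lemma measurable_scale (n : nat) (t : R) :
  measurable_fun setT (fun x : 'rV[R]_n => t *: x).
Proof.
apply/measurable_fun_rVP => i.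
rewrite (_ : _ \o _ = (fun x => t * x)%R \o rV_coord i); last first.
  by apply/funext => x /=; rewrite /rV_coord mxE.
exact: measurableT_comp (measurable_scale1 t) (measurable_rV_coord i).
Qed.

(** Induction on the dimension: the section at [x] of the preimage is the preimage of the section at
    [t * x], so the first coordinate contributes one further factor [t^-1]. *)
Lemma lebesgue_rV_scale (n : nat) (t : R) (A : set 'rV[R]_n) :
  (0 < t)%R -> measurable A ->
  lebesgue_rV R n ((fun x => t *: x) @^-1` A) = (t ^- n)%:E * lebesgue_rV R n A.
Proof.
move=> t0; elim: n A => [|n IH] A mA.
  rewrite expr0 invr1 mul1e; congr (lebesgue_rV R 0 _).
  by apply/seteqP; split=> x /=; rewrite (thinmx0 x) scaler0.
rewrite /= /lebesgue_cons /pushforward.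
set B := rV_cons (n:=n) @^-1` A.
have mB : measurable B.
  by rewrite -[B]setTI; apply: measurable_rV_cons.
have mN : measurable ((rV_cons (n:=n) @^-1` ((fun x => t *: x) @^-1` A))).
  rewrite -[X in measurable X]setTI; apply: measurable_rV_cons => //.
  by rewrite -[X in measurable X]setTI; apply: measurable_scale.
rewrite /product_measure1.
transitivity (\int[leb]_x ((t ^- n)%:E * lebesgue_rV R n (xsection B (t * x)%R))).
  apply: eq_integral => x _ /=.
  rewrite -IH; last exact: measurable_xsection.
  congr (lebesgue_rV R n _); apply/seteqP; split=> v;
    rewrite /xsection /= !inE /B /=;
    rewrite (_ : t *: rV_cons _ = rV_cons ((t * x)%R, t *: v))//;
    by apply/rowP => i; rewrite !mxE; case: unliftP => [j|] /= _; rewrite ?mxE.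
have mf : measurable_fun setT (fun x => lebesgue_rV R n (xsection B x)).
  exact: measurable_fun_xsection.
rewrite ge0_integralZl//; last 2 first.
- exact: (measurableT_comp mf (measurable_scale1 t)).
- by rewrite lee_fin invr_ge0 exprn_ge0 // ltW.
rewrite (ge0_integral_scale1 t0 mf)//.
by rewrite muleA -EFinM -invfM -exprSr.
Qed.

Lemma ge0_integral_scale (n : nat) (t : R) (f : 'rV[R]_n -> \bar R) :
  (0 < t)%R -> measurable_fun setT f -> (forall x, 0 <= f x) ->
  \int[lebesgue_rV R n]_x f (t *: x) = (t ^- n)%:E * \int[lebesgue_rV R n]_x f x.
Proof.
move=> t0 mf f0.
pose g : 'rV[R]_n -> 'rV[R]_n := fun x => t *: x.
have mg : measurable_fun setT g := measurable_scale t.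
transitivity (\int[pushforward (lebesgue_rV R n) g]_x f x).
  by rewrite ge0_integral_pushforward// preimage_setT.
have ti : (0 <= t ^- n)%R by rewrite invr_ge0 exprn_ge0 // ltW.
transitivity (\int[mscale (NngNum ti) (lebesgue_rV R n)]_x f x).
  apply: eq_measure_integral => A mA _.
  by rewrite /= /pushforward lebesgue_rV_scale.
by rewrite ge0_integral_mscale.
Qed.

End scaling.

(** * Measurability and the Euclidean norm on R^n *)

Section rV_measurability.
Context {R : realType} {n : nat}.

Lemma measurable_rV_box (A : 'I_n -> set (measurableTypeR R)) :
  (forall i, measurable (A i)) ->
  measurable [set x : 'rV[R]_n | forall i, A i (x 0 i)].
Proof.
move=> mA; rewrite (_ : mkset _ = \big[setI/setT]_(i < n) (@rV_coord R n i @^-1` A i)).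
  apply: bigsetI_measurable => i _; rewrite -[X in measurable X]setTI.
  exact: measurable_rV_coord.
rewrite -bigcap_seq; apply/seteqP; split=> x /= H i; first by move=> _; exact: H.
by apply: (H i); rewrite /= mem_index_enum.
Qed.

(* [x] is rounded down to the grid of mesh [1 / (k + 1)], which takes countably
   many values; [f] is the limit of its compositions with these roundings. *)
Lemma continuous_measurable_rV (f : 'rV[R]_n -> R) :
  continuous f -> measurable_fun setT (f : 'rV[R]_n -> measurableTypeR R).
Proof.
move=> cf.
pose z k (x : 'rV[R]_n) : 'rV[int]_n := \row_i Num.floor (k.+1%:R * x 0 i).
pose q k (v : 'rV[int]_n) : 'rV[R]_n := \row_i ((v 0 i)%:~R / k.+1%:R).
have mz k v : measurable [set x : 'rV[R]_n | z k x = v].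
  rewrite (_ : mkset _ = [set x : 'rV[R]_n | forall i,
      [set r : R | (v 0 i)%:~R / k.+1%:R <= r < (v 0 i + 1)%:~R / k.+1%:R] (x 0 i)]).
    apply: (@measurable_rV_box (fun i =>
      [set r : R | (v 0 i)%:~R / k.+1%:R <= r < (v 0 i + 1)%:~R / k.+1%:R])) => i.
    rewrite (_ : mkset _ = [set` `[(v 0 i)%:~R / k.+1%:R, (v 0 i + 1)%:~R / k.+1%:R[]).
      exact: measurable_itv.
    by apply/seteqP; split => r /=; rewrite in_itv.
  apply/seteqP; split=> x /=.
    move=> <- i; rewrite mxE ler_pdivrMr// ltr_pdivlMr// mulrC.
    by rewrite floor_le_tmp/= floorD1_gt.
  move=> H; apply/rowP => i; rewrite mxE; apply: floor_def.
  by have := H i; rewrite ler_pdivrMr// ltr_pdivlMr// mulrC.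
apply: (@measurable_fun_cvg _ 'rV[R]_n R setT (fun k x => f (q k (z k x))) f).
- move=> k _ Y mY; rewrite setTI.
  rewrite (_ : _ @^-1` _ = \bigcup_m (if unpickle m is Some v then
      if `[< Y (f (q k v)) >] then [set x | z k x = v] else set0 else set0)).
    apply: bigcupT_measurable => m; case: (unpickle m) => [v|//].
    by case: ifP => // _; exact: mz.
  apply/seteqP; split=> x /=.
    by move=> Yx; exists (pickle (z k x)) => //; rewrite pickleK asboolT.
  by case=> m _; case: (unpickle m) => [v|//]; case: ifP => // /asboolP Yv /= ->.
- move=> x _; suff qx : (fun k => q k (z k x)) @ \oo --> x.
    exact: (cvg_comp _ _ qx (cf x)).
  apply/cvgrPdist_lt => e e0.
  near=> k.
  rewrite [`|_|]mx_normrE; apply/bigmax_ltP; split=> //= -[i j] _ /=.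
  rewrite !mxE (ord1 i) /=.
  have k0 : 0 < k.+1%:R :> R by [].
  have -> : x 0 j - (Num.floor (k.+1%:R * x 0 j))%:~R / k.+1%:R =
    (k.+1%:R * x 0 j - (Num.floor (k.+1%:R * x 0 j))%:~R) / k.+1%:R.
    by rewrite mulrBl mulrAC divff ?mul1r // gt_eqF.
  rewrite normrM [X in _ * X]ger0_norm ?invr_ge0// ltr_pdivrMr//.
  rewrite ger0_norm ?subr_ge0 ?floor_le_tmp//.
  apply: (@lt_le_trans _ _ 1).
    by rewrite ltrBlDl -[X in _ + X]/(1%:~R) -intrD floorD1_gt.
  rewrite -ler_pdivrMl// mulr1.
  rewrite -[leRHS]invrK lef_pV2 ?posrE ?invr_gt0//; apply: ltW.
  by near: k; exact: (near_infty_natSinv_lt (PosNum e0)).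
Unshelve. all: by end_near. Qed.

Lemma measurable_enorm :
  measurable_fun setT (@enorm R n : 'rV[R]_n -> measurableTypeR R).
Proof.
apply: (@measurableT_comp _ _ _ _ _ _ (Num.sqrt : R -> R)).
  by apply: continuous_measurable_fun; exact: sqrt_continuous.
apply: measurable_sum => i; apply: measurable_funX; exact: measurable_rV_coord.
Qed.

End rV_measurability.

Section enorm.
Context {R : realType} {n : nat}.
Implicit Types x y : 'rV[R]_n.

Lemma sqr_enorm x : enorm x ^+ 2 = \sum_i x 0 i ^+ 2.
Proof. by rewrite sqr_sqrtr// sumr_ge0// => i _; rewrite sqr_ge0. Qed.

Lemma enorm_ge0 x : 0 <= enorm x.
Proof. exact: sqrtr_ge0. Qed.

Lemma enormZ (t : R) x : enorm (t *: x) = `|t| * enorm x.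
Proof.
rewrite /enorm -sqrtr_sqr -sqrtrM ?sqr_ge0// mulr_sumr.
by congr Num.sqrt; apply: eq_bigr => i _; rewrite mxE exprMn.
Qed.

Lemma enorm0 : enorm (0 : 'rV[R]_n) = 0.
Proof. by rewrite -(scale0r 0) enormZ normr0 mul0r. Qed.

Lemma enorm_eq0 x : (enorm x == 0) = (x == 0).
Proof.
apply/eqP/eqP => [x0|->]; last exact: enorm0.
have := sqr_enorm x; rewrite x0 expr0n /= => /esym/eqP.
rewrite psumr_eq0; last by move=> i _; rewrite sqr_ge0.
move=> /allP H; apply/rowP => i; rewrite mxE.
by have := H i (mem_index_enum i); rewrite /= sqrf_eq0 => /eqP.
Qed.

Lemma enorm_coord x i : `|x 0 i| <= enorm x.
Proof.
rewrite -sqrtr_sqr ler_wsqrtr// (bigD1 i)//= lerDl.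
by apply: sumr_ge0 => j _; rewrite sqr_ge0.
Qed.

(** The squared norm of [v - c *: e], the part of [v] orthogonal to [e], is the squared norm of [v]
    minus [c ^+ 2]. *)
Lemma Cauchy_Schwarz_unit (e v : 'rV[R]_n) :
  enorm e = 1 -> `|\sum_i e 0 i * v 0 i| <= enorm v.
Proof.
move=> e1; set c := \sum_i _.
have : 0 <= \sum_i (v 0 i - c * e 0 i) ^+ 2.
  by apply: sumr_ge0 => i _; rewrite sqr_ge0.
have -> : \sum_i (v 0 i - c * e 0 i) ^+ 2 =
    enorm v ^+ 2 - 2 * c * c + c ^+ 2 * enorm e ^+ 2.
  rewrite !sqr_enorm (_ : 2 * c * c = \sum_i 2 * c * (e 0 i * v 0 i)); last by rewrite -mulr_sumr.
  rewrite -sumrB mulr_sumr -big_split /=; apply: eq_bigr => i _; ring.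

rewrite e1 => H.
rewrite -(@ler_pXn2r _ 2)// ?nnegrE ?enorm_ge0// real_normK ?num_real//.
lra.
Qed.

End enorm.

(** * Polar coordinates *)

Section power_integral.
Context {R : realType}.
Local Notation leb := (@lebesgue_measure R).

Lemma derivable1_powerV (k : nat) (x : R) : 0 < x ->
  is_derive x (1 : R) (fun t : R => - (t ^- k.+1 / k.+1%:R)) (x ^- k.+2).
Proof.
move=> x0; have x0' : x != 0 by rewrite gt_eqF.
have xk : (fun t : R => t ^+ k.+1) x != 0 by rewrite expf_neq0.
have h : is_derive x (1 : R) (fun t : R => t ^+ k.+1) (k.+1%:R * x ^+ k).
  rewrite -[fun t => _]/(fun t => (id t) ^+ k.+1) -exprfctE.
  apply: (is_derive_eq (is_deriveX k.+1 (is_derive_id x 1))).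
  by rewrite /GRing.scale /= mulr1.
have H := is_deriveZ (- k.+1%:R^-1 : R) (@is_deriveV _ (fun t : R => t ^+ k.+1) x _ 1 xk h).
rewrite [X in is_derive _ _ X](_ : _ = - k.+1%:R^-1 *: (fun t : R => t ^- k.+1)); last first.
  by apply/funext => t; rewrite scalrfctE /GRing.scale /= mulNr mulrC.
apply: (is_derive_eq H); rewrite /GRing.scale /= !exprS.
have : x ^+ k != 0 by rewrite expf_neq0.
have : k.+1%:R != 0 :> R by rewrite pnatr_eq0.
move: (x ^+ k) (k.+1%:R) => y c c0 y0; field.
by rewrite y0 x0' c0.
Qed.

Lemma integral_powerV (k : nat) (a : R) : 0 < a ->
  (\int[leb]_(t in `[a, +oo[) (t ^- k.+2)%:E = (a ^- k.+1 / k.+1%:R)%:E)%E.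
Proof.
move=> a0.
pose F (t : R) := - (t ^- k.+1 / k.+1%:R).
rewrite (@ge0_continuous_FTC2y _ _ F a 0).
- by rewrite sub0e /F -EFinN opprK.
- by move=> x ax; rewrite invr_ge0 exprn_ge0// (le_trans _ ax)// ltW.
- apply: continuous_in_subspaceT => x; rewrite inE /= in_itv /= andbT => ax.
  have x0 : x != 0 by rewrite gt_eqF// (lt_le_trans a0).
  apply: (@cvgV _ _ _ _ (fun t : R => t ^+ k.+2)); first exact: expf_neq0.
  exact: exprn_continuous.
- rewrite -[X in _ --> X]oppr0; apply: cvgN.
  rewrite -[X in _ --> X](mul0r (k.+1%:R^-1)); apply: cvgM; last exact: cvg_cst.
  apply/(@gtr0_cvgV0 _ _ _ _ (fun t : R => t ^+ k.+1)).
    by near=> t; rewrite exprn_gt0.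
  apply/cvgryPge => A; near=> t.
  apply: (@le_trans _ _ t) => //; last by rewrite ler_eXnr.
- by move=> x ax; have [] := derivable1_powerV k (lt_trans a0 ax).
- have [] := derivable1_powerV k a0 => /derivable1_diffP/differentiable_continuous cF _.
  exact: cvg_at_right_filter cF.
- move=> x; rewrite in_itv /= andbT => ax.
  have D := derivable1_powerV k (lt_trans a0 ax).
  by rewrite derive1E derive_val.
Unshelve. all: by end_near. Qed.

End power_integral.

Section polar.
Context {R : realType} {m : nat}.
Local Notation n := m.+1.
Local Notation leb := (@lebesgue_measure R).
Local Notation lam := (lebesgue_rV R n).
Implicit Types x y : 'rV[R]_n.

Definition dir x : 'rV[R]_n := (enorm x)^-1 *: x.

(** The cone over the unit sphere; it serves as the space of directions. *)
Definition punctured_ball : set 'rV[R]_n := [set x | 0 < enorm x <= 1].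
Local Notation C := punctured_ball.
Local Notation B := (@unit_ball R n).

Lemma enorm_dir x : 0 < enorm x -> enorm (dir x) = 1.
Proof. by move=> x0; rewrite enormZ gtr0_norm ?invr_gt0// mulVf ?gt_eqF. Qed.

Lemma measurable_punctured_ball : measurable C.
Proof.
rewrite (_ : C = setT `&` @enorm R n @^-1` [set` `]0, 1]]).
  exact: measurable_enorm.
by rewrite setTI; apply/seteqP; split=> x; rewrite /= in_itv.
Qed.

Lemma cone_unit_sphere : cone (@unit_sphere R n) = C.
Proof.
apply/seteqP; split=> x.
  move=> [r [y y1 [/andP[r0 r1] ->]]]; rewrite /C /= enormZ y1 mulr1.
  by rewrite gtr0_norm// r0.
move=> /andP[x0 x1]; exists (enorm x), (dir x); first exact: enorm_dir.
split; first by rewrite x0.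
by rewrite scalerA divff ?scale1r// gt_eqF.
Qed.

Lemma measurable_ray (v : 'rV[R]_n) :
  measurable_fun setT (fun r : measurableTypeR R => r *: v).
Proof.
apply/measurable_fun_rVP => i.
rewrite (_ : _ \o _ = (fun r => r * v 0 i)); first exact: mulrr_measurable.
by apply/funext => r /=; rewrite /rV_coord mxE.
Qed.

Lemma measurable_scale_pair :
  measurable_fun setT (fun p : 'rV[R]_n * measurableTypeR R => p.2 *: p.1).
Proof.
apply/measurable_fun_rVP => i.
rewrite (_ : _ \o _ = (fun p => p.2 * rV_coord i p.1)); last first.
  by apply/funext => r /=; rewrite /rV_coord mxE.
apply: measurable_funM => //.
exact: measurableT_comp (measurable_rV_coord i) measurable_fst.
Qed.

Lemma rV_set0E :
  [set 0] = [set x : 'rV[R]_n | forall i : 'I_n, [set 0 : R] (x 0 i)].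
Proof.
apply/seteqP; split=> x /=; first by move=> -> i; rewrite mxE.
by move=> H; apply/rowP => i; rewrite H mxE.
Qed.

Lemma measurable_rV0 : measurable [set 0 : 'rV[R]_n].
Proof. by rewrite rV_set0E; apply: (@measurable_rV_box R n (fun=> [set 0])). Qed.

Lemma lebesgue_rV0 : lam [set 0] = 0%E.
Proof.
rewrite rV_set0E (@lebesgue_rV_box R n (fun=> [set 0])); last first.
  by move=> i; exact: measurable_set1.
by rewrite big_ord_recl lebesgue_measure_set1 mul0e.
Qed.

Local Open Scope ereal_scope.

Variable F : 'rV[R]_n -> \bar R.
Hypotheses (mF : measurable_fun setT F) (F0 : forall x, 0 <= F x).

Let FB := F \_ B.
Let mFB : measurable_fun setT FB.
Proof.
apply/(measurable_restrictT _ (@measurable_unit_ball R n)).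
exact: measurable_funTS.
Qed.
Let FB0 x : 0 <= FB x.
Proof. by rewrite /FB patchE; case: ifP. Qed.

(** The integrand whose two iterated integrals give the polar formula. For fixed [x], the
    substitution r = |x| t turns the integral over [t] into the ray integral in direction [dir x].
    For fixed [t], the substitution y = t x gives |y|^n t^(-(m+2)) on |y| <= t, and the integral of
    this over t >= |y| is 1/n. *)
Let Phi (p : 'rV[R]_n * measurableTypeR R) : \bar R :=
  if ((0 < enorm p.1) && (enorm p.1 <= 1) && (0 < p.2))%R then
    (p.2 ^+ m * enorm p.1 ^+ n)%:E * FB (p.2 *: p.1) else 0.

Let enorm1 : measurable_fun setT
  (fun p : 'rV[R]_n * measurableTypeR R => enorm p.1 : measurableTypeR R).
Proof. exact: measurableT_comp measurable_enorm measurable_fst. Qed.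

Let mPhi : measurable_fun setT Phi.
Proof.
apply: measurable_fun_ifT => //.
  apply: measurable_and.
    apply: measurable_and.
      exact: (@measurable_fun_ltr _ _ R _ (cst 0%R) (fun p => enorm p.1)).
    exact: (@measurable_fun_ler _ _ R _ (fun p => enorm p.1) (cst 1%R)).
  by apply: (@measurable_fun_ltr _ _ R _ (cst 0%R) snd) => //; exact: measurable_snd.
apply: emeasurable_funM; last exact: measurableT_comp mFB measurable_scale_pair.
apply/measurable_EFinP; apply: measurable_funM; apply: measurable_funX => //.
Qed.

Let Phi0 p : 0 <= Phi p.
Proof.
rewrite /Phi; case: ifP => // /andP[/andP[x0 x1] t0].
by rewrite mule_ge0// lee_fin mulr_ge0// exprn_ge0// ltW.
Qed.

Let integral_Phi_t x : \int[leb]_t Phi (x, t) =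
  ((fun x => \int[leb]_(r in `]0%R, 1%R[) (F (r *: dir x) * (r ^+ m)%:E)) \_ C) x.
Proof.
rewrite patchE; case: ifPn => [|xC]; last first.
  apply: integral0_eq => t _; rewrite /Phi; case: ifP => // /andP[h _].
  by case/negP: xC; rewrite inE.
rewrite inE => /andP[x0 x1].
pose h (r : measurableTypeR R) : \bar R :=
  if (0 < r)%R then (r ^+ m)%:E * FB (r *: dir x) else 0.
have mh : measurable_fun setT h.
  apply: measurable_fun_ifT => //.
    exact: (@measurable_fun_ltr _ _ R _ (cst 0%R) id).
  apply: emeasurable_funM; last exact: measurableT_comp mFB (measurable_ray _).
  by apply/measurable_EFinP; apply: measurable_funX.
have h0 r : 0 <= h r.
  by rewrite /h; case: ifP => // r0; rewrite mule_ge0// lee_fin exprn_ge0// ltW.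
transitivity (\int[leb]_t ((enorm x)%:E * h (enorm x * t)%R)).
  apply: eq_integral => t _; rewrite /Phi /h /= x0 x1 /= pmulr_rgt0//.
  case: ifP => _; last by rewrite mule0.
  rewrite muleA -EFinM; congr (_%:E * FB _).
    by rewrite exprMn mulrA -exprS mulrC.
  by rewrite scalerA mulrAC divff ?mul1r// gt_eqF.
rewrite ge0_integralZl//; last 2 first.
- exact: (measurableT_comp mh (measurable_scale1 _)).
- by rewrite lee_fin ltW.
rewrite (ge0_integral_scale1 x0 mh)// muleA -EFinM divff ?gt_eqF// mul1e.
rewrite [RHS]integral_mkcond; apply: eq_integral => r _.
rewrite /h patchE mem_setE in_itv /=.
case: ifPn => r0 //=; rewrite /FB patchE.
have E : (enorm (r *: dir x) = r).
  by rewrite enormZ enorm_dir// mulr1 gtr0_norm.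
have -> : (r *: dir x \in B) = (r < 1)%R.
  by apply/idP/idP; rewrite inE /unit_ball /= E.
by case: ifP => _; rewrite ?mule0// muleC.
Qed.

Let integral_Phi_x t : \int[lam]_x Phi (x, t) =
  \int[lam]_y (if ((0 < enorm y) && (enorm y <= t))%R then
    (enorm y ^+ n * (t `^ (-1)) ^+ m.+2)%:E * FB y else 0).
Proof.
have [t0|t0] := ltP 0%R t; last first.
  rewrite !integral0_eq// => x _.
    by case: ifP => // /andP[y0 yt]; move: t0; rewrite leNgt (lt_le_trans y0 yt).
  by rewrite /Phi /= (le_gtF t0) andbF.
pose K y : \bar R := if ((0 < enorm y) && (enorm y <= t))%R then
    (enorm y ^+ n / t)%:E * FB y else 0.
have mE : measurable_fun setT (fun y => enorm y : measurableTypeR R).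
  exact: measurable_enorm.
have mK : measurable_fun setT K.
  apply: measurable_fun_ifT => //.
    apply: measurable_and.
      exact: (@measurable_fun_ltr _ _ R _ (cst 0%R) (fun y => enorm y)).
    exact: (@measurable_fun_ler _ _ R _ (fun y => enorm y) (cst t)).
  apply: emeasurable_funM => //; apply/measurable_EFinP; apply: measurable_funM => //.
  exact: measurable_funX.
have K0 y : 0 <= K y.
  rewrite /K; case: ifP => // /andP[y0 yt].
  by rewrite mule_ge0// lee_fin divr_ge0// ?exprn_ge0// ltW.
transitivity (\int[lam]_x K (t *: x)).
  apply: eq_integral => x _; rewrite /Phi /K enormZ gtr0_norm//= t0 andbT.
  rewrite pmulr_rgt0// ger_pMr//; case: ifP => // _.
  congr (_%:E * _); rewrite exprMn (exprS t); field; exact: lt0r_neq0.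
rewrite (ge0_integral_scale t0 mK K0) -ge0_integralZl//; last first.
  by rewrite lee_fin invr_ge0 exprn_ge0// ltW.
apply: eq_integral => y _; rewrite /K; case: ifP => _; last by rewrite mule0.
rewrite muleA -EFinM; congr (_%:E * _).
rewrite powR_inv1; last exact: ltW.
by rewrite mulrCA exprVn -invfM -exprSr.
Qed.

Lemma polar_integral :
  \int[lam]_(x in C) \int[leb]_(r in `]0%R, 1%R[) (F (r *: dir x) * (r ^+ m)%:E)
  = (n%:R^-1)%:E * \int[lam]_(x in B) F x.
Proof.
rewrite integral_mkcond.
under eq_integral do rewrite -integral_Phi_t.
rewrite (fubini_tonelli Phi)//.
under eq_integral do rewrite integral_Phi_x.
(* The real power with exponent -1 is the inverse on nonnegative reals, and [measurable_powR] makes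
   it measurable. *)
pose Psi (p : 'rV[R]_n * measurableTypeR R) : \bar R :=
  if ((0 < enorm p.1) && (enorm p.1 <= p.2))%R then
    (enorm p.1 ^+ n * (p.2 `^ (-1)) ^+ m.+2)%:E * FB p.1 else 0.
have mPsi : measurable_fun setT Psi.
  apply: measurable_fun_ifT => //.
    apply: measurable_and.
      exact: (@measurable_fun_ltr _ _ R _ (cst 0%R) (fun p => enorm p.1)).
    by apply: (@measurable_fun_ler _ _ R _ (fun p => enorm p.1) snd) => //;
      exact: measurable_snd.
  apply: emeasurable_funM; last exact: measurableT_comp mFB measurable_fst.
  apply/measurable_EFinP; apply: measurable_funM; apply: measurable_funX => //.
  exact: measurableT_comp (measurable_powR _) measurable_snd.
have Psi0 p : 0 <= Psi p.
  rewrite /Psi; case: ifP => // /andP[y0 yt].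
  by rewrite mule_ge0// lee_fin mulr_ge0// exprn_ge0// ?powR_ge0// ltW.
rewrite -(fubini_tonelli Psi)//.
rewrite [in RHS]integral_mkcond -/FB -ge0_integralZl//.
apply: ge0_ae_eq_integral => //.
- exact: (measurable_fun_fubini_tonelli_F Psi).
- exact: emeasurable_funM.
- by move=> x _; exact: integral_ge0.
- by move=> x _; apply: mule_ge0; [rewrite lee_fin|exact: FB0].
(* At the origin the inner integral is 0 whatever [FB 0] is, so equality is proved off this null
   set. *)
exists [set (0%R : 'rV[R]_n)]; split; first exact: measurable_rV0.
  exact: lebesgue_rV0.
move=> y /= H; apply: contrapT => y0; apply: H => _.
have {}y0 : (0 < enorm y)%R.
  by rewrite lt_neqAle enorm_ge0 andbT eq_sym enorm_eq0; apply/eqP.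
transitivity (\int[leb]_(t in `[enorm y, +oo[) ((t ^- m.+2)%:E * ((enorm y ^+ n)%:E * FB y))).
  rewrite [RHS]integral_mkcond; apply: eq_integral => t _.
  rewrite patchE mem_setE in_itv /= andbT /Psi /= y0 /=; case: ifP => // yt.
  rewrite muleA -EFinM; congr (_%:E * _); rewrite powR_inv1; last first.
    by rewrite (le_trans _ yt)// ltW.
  by rewrite exprVn mulrC.
rewrite ge0_integralZr//; last 3 first.
- apply/measurable_EFinP; apply: (eq_measurable_fun (fun t : R => (t `^ (-1)) ^+ m.+2)%R).
    move=> t; rewrite inE /= in_itv /= andbT => yt; rewrite powR_inv1 ?exprVn//.
    by rewrite (le_trans _ yt)// ltW.
  by apply: measurable_funTS; apply: measurable_funX; exact: measurable_powR.
- move=> t; rewrite /= in_itv /= andbT => yt.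
  by rewrite lee_fin invr_ge0 exprn_ge0// (le_trans _ yt)// ltW.
- by rewrite mule_ge0// lee_fin exprn_ge0// ltW.
rewrite integral_powerV// muleA -EFinM; congr (_%:E * _).
by rewrite mulrAC mulVf ?mul1r// expf_neq0// gt_eqF.
Qed.

End polar.

(** * Test functions along rays *)

Section chain_rule.
Context {R : realType} {n : nat}.
Implicit Types (f : 'rV[R]_n -> R) (x p e v : 'rV[R]_n).

Lemma is_derive_line f p e (s : R) : derivable f (p + s *: e) e ->
  is_derive s (1 : R) (fun s => f (p + s *: e)) ('D_e f (p + s *: e)).
Proof.
move=> df.
have E : (fun h : R => h^-1 *: (((fun s => f (p + s *: e)) \o shift s) (h *: (1 : R)) -
      f (p + s *: e))) =
    (fun h : R => h^-1 *: ((f \o shift (p + s *: e)) (h *: e) - f (p + s *: e))).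
  apply/funext => h; congr (_ *: (f _ - _)).
  by rewrite /= [h *: 1]mulr1 scalerDl addrCA.
by split; rewrite /derivable /derive E.
Qed.

(** Free of any order between [a] and [b], because the coordinate increments in [increment_C1] can
    have either sign. *)
Lemma MVT_dist (g dg : R -> R) (a b : R) :
  (forall s, is_derive s (1 : R) g (dg s)) ->
  exists2 c, `|c - a| <= `|b - a| & g b - g a = dg c * (b - a).
Proof.
move=> H.
have cg c d : {within `[c, d], continuous g}.
  apply: derivable_within_continuous => s _; exact: ex_derive.
have [ab|ba] := leP a b.
  have [c] := MVT_segment ab (fun s _ => H s) (cg _ _).
  rewrite in_itv /= => /andP[ac cb] gE; exists c => //.
  by rewrite !ger0_norm ?subr_ge0// lerD2r.
have [c] := MVT_segment (ltW ba) (fun s _ => H s) (cg _ _).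
rewrite in_itv /= => /andP[bc ca] gE; exists c; last first.
  by rewrite -[LHS]opprB gE -mulrN opprB.
by rewrite !ler0_norm ?subr_le0 ?(ltW ba)// lerN2 lerD2r.
Qed.

(* The increment of [f] along [h *: v] is split into increments along the
   coordinate axes, to each of which the mean value theorem applies. *)
Lemma increment_C1 f v x (eps : R) : 0 < eps ->
  (forall i, {for x, continuous (partial i f)}) ->
  (forall i y, derivable f y (delta_mx 0 i)) ->
  \forall h \near (0 : R), `|f (x + h *: v) - f x - h * \sum_i v 0 i * partial i f x|
    <= `|h| * (\sum_i `|v 0 i| * eps).
Proof.
move=> eps0 cf df.
have [d d0 Hd] : exists2 d : R, 0 < d & forall y : 'rV[R]_n, (forall i, `|y 0 i - x 0 i| < d) ->
    forall i, `|partial i f y - partial i f x| <= eps.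
  have H i : \forall y \near x, `|partial i f y - partial i f x| <= eps.
    have /cvgrPdist_le /(_ eps eps0) := cf i.
    by apply: filterS => y; rewrite distrC.
  have [d /= d0 {}H] := (nbhs_ballP x _).1 (@filter_forall _ 'I_n _ (nbhs x) _ H); exists d => // y yx; apply: H.
  by split=> // i j; rewrite (ord1 i) /ball /= distrC.
(* The condition |h| M < d keeps every point of the staircase from [x] to [x + h *: v] in the cube
   of radius [d]; the summand 1 makes [M] positive even for [v = 0]. *)
pose M := \sum_i `|v 0 i| + 1.
have M0 : 0 < M by rewrite ltr_wpDl// sumr_ge0.
have vM i : `|v 0 i| < M.
  rewrite (@le_lt_trans _ _ (\sum_i `|v 0 i|))// ?ltrDl//.
  by rewrite (bigD1 i)//= lerDl sumr_ge0.
near=> h.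
have hd : `|h| * M < d.
  rewrite -ltr_pdivlMr//; near: h.
  have dM0 : 0 < d / M by rewrite divr_gt0.
  exists (d / M) => //= h; rewrite /ball_ /= sub0r normrN; exact.
(* The corners of the staircase: [tr j] keeps the first [j] coordinates of [v]. *)
pose tr j : 'rV[R]_n := \row_i (if (i < j)%N then v 0 i else 0).
have tr0 : tr 0%N = 0 by apply/rowP => i; rewrite !mxE.
have trn : tr n = v by apply/rowP => i; rewrite !mxE ltn_ord.
have trS (j : 'I_n) : tr j.+1 = tr j + v 0 j *: delta_mx 0 j.
  apply/rowP => i; rewrite !mxE eqxx /= ltnS leq_eqVlt.
  have [->|ij] := eqVneq i j; first by rewrite eqxx ltnn /= mulr1 add0r.
  have -> : (i == j :> nat) = false by apply/negbTE.
  by rewrite mulr0 addr0.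
have T : f (x + h *: v) - f x = \sum_(j < n) (f (x + h *: tr j.+1) - f (x + h *: tr j)).
  rewrite -(big_mkord xpredT (fun j => f (x + h *: tr j.+1) - f (x + h *: tr j))).
  by rewrite telescope_sumr// trn tr0 scaler0 addr0.
rewrite T mulr_sumr -sumrB mulr_sumr; apply: (le_trans (ler_norm_sum _ _ _)).
apply: ler_sum => j _.
pose g s := f ((x + h *: tr j) + s *: delta_mx 0 j).
have [c cj gE] := @MVT_dist g _ 0 (h * v 0 j)
  (fun s => is_derive_line (df j ((x + h *: tr j) + s *: delta_mx 0 j))).
rewrite !subr0 in cj gE.
have -> : f (x + h *: tr j.+1) - f (x + h *: tr j) = g (h * v 0 j) - g 0.
  by rewrite /g scale0r addr0 trS scalerDr scalerA addrA.
rewrite gE -/(partial j f _); set y := x + h *: tr j + _.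
have -> : partial j f y * (h * v 0 j) - h * (v 0 j * partial j f x) =
  h * (v 0 j * (partial j f y - partial j f x)) by ring.
rewrite !normrM ler_wpM2l// ler_wpM2l//; apply: Hd => i.
have xbc (a b d' : R) : a + b + d' - a = b + d' by ring.
rewrite /y !mxE eqxx /= xbc.
apply: (le_lt_trans _ hd).
have [->|ij] := eqVneq i j.
  by rewrite ltnn mulr1 mulr0 add0r (le_trans cj)// normrM ler_wpM2l// ltW.
rewrite mulr0 addr0; case: ifP => _; last by rewrite mulr0 normr0 mulr_ge0// ltW.
by rewrite normrM ler_wpM2l// ltW.
Unshelve. all: by end_near. Qed.

(** [smooth] speaks only of coordinate derivatives; their continuity upgrades them, through the
    first-order expansion [increment_C1], to a derivative along any line through the origin. *)
Lemma is_derive_radial f v (t : R) :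
  (forall i, continuous (partial i f)) ->
  (forall i y, derivable f y (delta_mx 0 i)) ->
  is_derive t (1 : R) (fun s => f (s *: v)) (\sum_i v 0 i * partial i f (t *: v)).
Proof.
move=> cf df; set L := \sum_i _.
have H : (fun h : R => h^-1 *: (((fun s => f (s *: v)) \o shift t) (h *: (1 : R)) -
    f (t *: v))) @ 0^' --> L.
  apply/cvgrPdist_le => eps eps0.
  pose M := \sum_i `|v 0 i| + 1.
  have M0 : 0 < M by rewrite ltr_wpDl// sumr_ge0.
  have e0 : 0 < eps / M by rewrite divr_gt0.
  have := increment_C1 v e0 (fun i => cf i (t *: v)) df.
  rewrite -/L => H; near=> h.
  have h0 : h != 0 by near: h; exact: nbhs_dnbhs_neq.
  have H2 : `|f (t *: v + h *: v) - f (t *: v) - h * L| <=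
      `|h| * (\sum_i `|v 0 i| * (eps / M)).
    near: h; exact: (nbhs_dnbhs H).
  rewrite distrC /=.
  have -> : (h *: 1 + t) *: v = t *: v + h *: v.
    by rewrite [h *: 1]mulr1 scalerDl addrC.
  have -> : h^-1 *: (f (t *: v + h *: v) - f (t *: v)) - L =
      h^-1 * (f (t *: v + h *: v) - f (t *: v) - h * L).
    by rewrite [RHS]mulrBr mulKf.
  rewrite normrM normfV ler_pdivrMl ?normr_gt0// (le_trans H2)// ler_wpM2l//.
  rewrite -mulr_suml mulrC -mulrA; apply: ler_piMr; first exact: ltW.
  by rewrite ler_pdivrMl// mulr1 lerDl.
split; first by apply/cvg_ex; exists L.
exact/cvg_lim.
Unshelve. all: by end_near. Qed.

End chain_rule.

Section test_function_rays.
Context {R : realType} {n : nat}.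
Local Notation leb := (@lebesgue_measure R).
Variables (U : set 'rV[R]_n) (phi : 'rV[R]_n -> R).
Hypothesis test_phi : test_function U phi.

Lemma continuous_test : continuous phi.
Proof. by have [/(_ [::])[]] := test_phi. Qed.

Lemma continuous_partial_test i : continuous (partial i phi).
Proof. by have [/(_ [:: i])[]] := test_phi. Qed.

Lemma derivable_test i x : derivable phi x (delta_mx 0 i).
Proof. by have [/(_ [::])[]] := test_phi. Qed.

Lemma test_eq0 x : ~ U x -> phi x = 0.
Proof.
move=> Ux; apply/eqP; apply: contra_notT Ux => phix.
by have [_ _] := test_phi; apply; apply: subset_closure.
Qed.

Lemma continuous_radial_derivative (e : 'rV[R]_n) :
  continuous (fun t : R => \sum_i e 0 i * partial i phi (t *: e)).
Proof.
apply: (@continuous_big R 'I_n +%R 0 xpredT _ R (index_enum _)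
  (fun i t => e 0 i * partial i phi (t *: e))) => [|i _].
  exact: add_continuous.
move=> t; apply: cvgM; first exact: cvg_cst.
have st : (fun t : R => t *: e) @ t --> t *: e by exact: scalel_continuous.
exact: (cvg_comp _ _ st (@continuous_partial_test i (t *: e))).
Qed.

(** The fundamental theorem of calculus on [r, 1]: the boundary term at 1 vanishes because [e] lies
    outside [U]. *)
Lemma test_ray_le (e : 'rV[R]_n) (r : R) : r < 1 -> ~ U e ->
  (`|phi (r *: e)|%:E <=
   \int[leb]_(t in `]r, 1%R[) `|\sum_i e 0 i * partial i phi (t *: e)|%:E)%E.
Proof.
move=> r1 Ue; set D := fun t : R => \sum_i e 0 i * partial i phi (t *: e).
have dphi t : is_derive t (1 : R) (fun s => phi (s *: e)) (D t).
  apply: is_derive_radial; first exact: continuous_partial_test.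
  exact: derivable_test.
have cphi : continuous (fun s : R => phi (s *: e)).
  by move=> t; apply/differentiable_continuous/derivable1_diffP; exact: ex_derive.
have mD A : measurable_fun A D.
  apply: measurable_funTS; apply: continuous_measurable_fun.
  exact: continuous_radial_derivative.
have H : (\int[leb]_(t in `[r, 1%R]) (D t)%:E = (phi (1%R *: e))%:E - (phi (r *: e))%:E)%E.
  apply: (@continuous_FTC2 _ D (fun s => phi (s *: e)) r 1 r1).
  - by apply: continuous_subspaceT; exact: continuous_radial_derivative.
  - split=> [t _||]; first exact: ex_derive.
    + exact/cvg_at_right_filter/cphi.
    + exact/cvg_at_left_filter/cphi.
  - by move=> t _; rewrite derive1E derive_val.
rewrite scale1r (test_eq0 Ue) sub0e in H.
have -> : (`|phi (r *: e)|%:E = `| \int[leb]_(t in `[r, 1%R]) (D t)%:E|)%E.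
  by rewrite H abseN.
apply: (le_trans (le_abse_integral _ _ _)) => //.
  by apply/measurable_EFinP; exact: mD.
rewrite integral_itv_bndoo//.
by apply/measurable_EFinP; apply: measurableT_comp => //; exact: mD.
Qed.

End test_function_rays.

(** If [f] exceeded [c] on all of [D] outside [N], then [f - c] would be positive there with
    integral at most 0, hence zero almost everywhere on a set of positive measure. *)
Lemma exists_le_average d (T : measurableType d) (R : realType)
    (mu : {measure set T -> \bar R}) (D N : set T) (f : T -> \bar R) (c : R) :
  measurable D -> (0 < mu D < +oo)%E -> measurable N -> mu N = 0%E -> 0 <= c ->
  measurable_fun D f -> (forall x, D x -> 0 <= f x)%E ->
  (\int[mu]_(x in D) f x <= c%:E * mu D)%E ->
  exists x, [/\ D x, ~ N x & (f x <= c%:E)%E].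
Proof.
move=> mD /andP[D0 Doo] mN N0 c0 mf f0 If; apply: contrapT => nox.
pose E := D `\` N.
have mE : measurable E by exact: measurableD.
have muE : mu E = mu D.
  have DN0 : mu (D `&` N) = 0%E.
    by apply: (@subset_measure0 _ _ _ mu _ N) => //; exact: measurableI.
  apply/esym; rewrite (measureDI mu mD mN).
  by rewrite -[X in (_ + X)%E]/(mu (D `&` N)) DN0 adde0.
have fc x : E x -> (c%:E < f x)%E.
  by move=> [Dx Nx]; rewrite ltNge; apply/negP => fx; apply: nox; exists x.
have mfE : measurable_fun E f by apply: measurable_funS mf => // x [].
pose h x := (f x - c%:E)%E.
have mh : measurable_fun E h by apply: emeasurable_funB.
have h0 x : E x -> (0 <= h x)%E by move=> /fc fx; rewrite sube_ge0 // ltW.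
have : (\int[mu]_(x in E) f x <= c%:E * mu D)%E.
  by apply: le_trans If; apply: ge0_subset_integral => // x [].
have -> : (\int[mu]_(x in E) f x = \int[mu]_(x in E) (h x + (cst c%:E) x))%E.
  by apply: eq_integral => x _; rewrite /h subeK.
rewrite ge0_integralD//.
rewrite integral_cst// muE -[leRHS]add0e leeD2rE//; last first.
  by rewrite fin_numM// ge0_fin_numE.
move=> I0.
have : (\int[mu]_(x in E) `|h x| = 0)%E.
  apply/eqP; rewrite eq_le integral_ge0// andbT.
  rewrite (eq_integral h)// => x; rewrite inE => Ex.
  by rewrite gee0_abs// h0.
move/ae_eq_integral_abs => /(_ mE mh) [M [mM M0 subM]].
have : (mu E <= mu M)%E.
  apply: le_measure; rewrite ?inE// => x Ex; apply: subM => /= /(_ Ex) hx.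
  by have := fc _ Ex; rewrite -sube_gt0 -/(h x) hx ltxx.
by rewrite M0 muE leNgt D0.
Qed.

(** * Volume of the ball and integrals of radial functions *)

Section ball_volume.
Context {R : realType} {m : nat}.
Local Notation n := m.+1.
Local Notation leb := (@lebesgue_measure R).
Local Notation lam := (lebesgue_rV R n).
Local Notation C := (@punctured_ball R m).
Local Notation B := (@unit_ball R n).

Lemma punctured_ball_fin : (lam C < +oo)%E.
Proof.
pose A := fun _ : 'I_n => [set` `[(-1 : R), 1]] : set (measurableTypeR R).
apply: (@le_lt_trans _ _ (lam [set x : 'rV[R]_n | forall i, A i (x 0 i)])).
  apply: le_measure; rewrite ?inE.
  - exact: measurable_punctured_ball.
  - by apply: measurable_rV_box => i; exact: measurable_itv.
  - move=> x /andP[_ x1] i; rewrite /A /= in_itv /= -ler_norml.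
    exact: (le_trans (enorm_coord x i)).
rewrite (lebesgue_rV_box (A := A)); last by move=> i; exact: measurable_itv.
rewrite (eq_bigr (fun=> 2%:E)); last first.
  move=> i _; rewrite /A lebesgue_measure_itv /= lte_fin ifT; last by lra.
  by rewrite -EFinB; congr _%:E; lra.
by rewrite prodEFin ltry.
Qed.

Lemma punctured_ball_gt0 : (0 < lam C)%E.
Proof.
(* A box of positive volume inside the punctured ball: each squared coordinate is at most 1/n, so
   they sum to at most 1. *)
pose A := fun _ : 'I_n => [set` `]0, (n%:R^-1 : R)]] : set (measurableTypeR R).
apply: (@lt_le_trans _ _ (lam [set x : 'rV[R]_n | forall i, A i (x 0 i)])); last first.
  apply: le_measure; rewrite ?inE.
  - by apply: measurable_rV_box => i; exact: measurable_itv.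
  - exact: measurable_punctured_ball.
  - move=> x Ax; apply/andP; split.
      have := Ax ord0; rewrite /A /= in_itv /= => /andP[x0 _].
      by apply: (lt_le_trans _ (enorm_coord x ord0)); rewrite gtr0_norm.
    rewrite -(@ler_pXn2r _ 2)// ?nnegrE ?enorm_ge0// expr1n sqr_enorm.
    apply: (@le_trans _ _ (\sum_(i < n) n%:R^-1 : R)); last first.
      by rewrite sumr_const card_ord -[_ *+ _]mulr_natl divff// pnatr_eq0.
    apply: ler_sum => i _; have := Ax i; rewrite /A /= in_itv /= => /andP[x0 xn].
    rewrite -[leRHS]mulr1 expr2; apply: ler_pM => //; try exact: ltW.
    by apply: (le_trans xn); rewrite invf_le1// ler1n.
rewrite (lebesgue_rV_box (A := A)); last by move=> i; exact: measurable_itv.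
rewrite (eq_bigr (fun=> (n%:R^-1 : R)%:E)); last first.
  move=> i _; rewrite /A lebesgue_measure_itv /= lte_fin invr_gt0 ltr0n /=.
  by rewrite sube0.
by rewrite prodEFin lte_fin prodr_gt0// => i _; rewrite invr_gt0.
Qed.

(** The volume is finite, so the [fine] in [omega] discards nothing. *)
Lemma omegaE : (n%:R%:E * lam C)%E = (omega R n)%:E.
Proof.
rewrite /omega /sphere_measure cone_unit_sphere fineK//.
by rewrite fin_numM// ge0_fin_numE// punctured_ball_fin.
Qed.

Lemma omega_gt0 : 0 < omega R n.
Proof. by rewrite -lte_fin -omegaE mule_gt0// punctured_ball_gt0. Qed.

Local Open Scope ereal_scope.

(** For a radial integrand the ray integral in [polar_integral] is the same for all directions. *)
Lemma radial_integral (h : R -> \bar R) :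
  measurable_fun setT (h : measurableTypeR R -> \bar R) -> (forall r, 0 <= h r) ->
  \int[lam]_(x in B) h (enorm x) =
  (omega R n)%:E * \int[leb]_(r in `]0%R, 1%R[) (h r * (r ^+ m)%:E).
Proof.
move=> mh h0.
have mF : measurable_fun setT (fun x : 'rV[R]_n => h (enorm x)).
  exact: measurableT_comp mh measurable_enorm.
have := polar_integral mF (fun x => h0 (enorm x)).
rewrite (eq_integral (cst (\int[leb]_(r in `]0%R, 1%R[) (h r * (r ^+ m)%:E)))); last first.
  move=> x; rewrite inE => /andP[x0 _].
  apply: eq_integral => r; rewrite inE /= in_itv /= => /andP[r0 _].
  by rewrite enormZ enorm_dir// mulr1 gtr0_norm.
rewrite integral_cst; last exact: measurable_punctured_ball.
move=> /(congr1 (fun z => n%:R%:E * z)).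
rewrite [X in _ = X]muleA -EFinM divff ?pnatr_eq0// mul1e => <-.
by rewrite -omegaE -muleA [lam C * _]muleC.
Qed.

(** Carries what holds at almost every radius of one chosen ray to almost every point of the
    ball. *)
Lemma radial_negligible (N : set (measurableTypeR R)) :
  measurable N -> leb N = 0 -> lam (B `&` @enorm R n @^-1` N) = 0.
Proof.
move=> mN N0.
have mEN : measurable (@enorm R n @^-1` N).
  by rewrite -[X in measurable X]setTI; apply: measurable_enorm.
have := @radial_integral (fun r => (\1_N r)%:E).
rewrite (_ : \int[lam]_(x in B) _ = lam (B `&` @enorm R n @^-1` N)); last first.
  rewrite setIC -integral_indic//; last exact: measurable_unit_ball.
move=> ->; last 2 first.
- by apply/measurable_EFinP; exact: measurable_indic.
- by move=> r; rewrite lee_fin.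
rewrite (_ : \int[leb]_(r in _) _ = 0) ?mule0//.
rewrite (@ge0_ae_eq_integral _ _ _ _ _ _ (cst 0)) ?integral0//.
- apply: emeasurable_funM; apply/measurable_EFinP; first exact: measurable_indic.
  exact: measurable_funX.
- move=> r; rewrite /= in_itv /= => /andP[r0 _].
  by rewrite mule_ge0// lee_fin// exprn_ge0// ltW.
- exists N; split => // r /= H; apply: contrapT => Nr; apply: H => _.
  by rewrite indicE memNset// mul0e.
Qed.

End ball_volume.

(** * Almost every ray *)

Section almost_every_ray.
Context {R : realType} {m : nat}.
Local Notation n := m.+1.
Local Notation leb := (@lebesgue_measure R).
Local Notation lam := (lebesgue_rV R n).
Local Notation C := (@punctured_ball R m).
Local Notation B := (@unit_ball R n).
Local Open Scope ereal_scope.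

Lemma integrable_ge0_finite_ae d (T : measurableType d)
    (mu : {measure set T -> \bar R}) (D : set T) (f : T -> \bar R) :
  measurable D -> measurable_fun D f -> (forall x, D x -> 0 <= f x) ->
  \int[mu]_(x in D) f x < +oo ->
  exists N, [/\ measurable N, mu N = 0 & forall x, D x -> ~ N x -> f x < +oo].
Proof.
move=> mD mf f0 foo.
have /(integrable_ae mD)[N [mN N0 subN]] : mu.-integrable D f.
  apply/integrableP; split => //; rewrite (eq_integral f)// => x.
  by rewrite inE => Dx; rewrite gee0_abs// f0.
exists N; split => // x Dx Nx; rewrite -ge0_fin_numE ?f0//.
by apply: contrapT => fx; apply: Nx; apply: subN => /= /(_ Dx).
Qed.

Lemma measurable_dir_pair :
  measurable_fun setT (fun p : 'rV[R]_n * measurableTypeR R => p.2 *: dir p.1).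
Proof.
apply/measurable_fun_rVP => i.
rewrite (_ : _ \o _ = (fun p => p.2 * ((enorm p.1 `^ (-1)) * rV_coord i p.1)))%R; last first.
  by apply/funext => p /=; rewrite /rV_coord !mxE powR_inv1// enorm_ge0.
apply: measurable_funM; first exact: measurable_snd.
apply: measurable_funM; last first.
  exact: measurableT_comp (measurable_rV_coord i) measurable_fst.
apply: (measurableT_comp (measurable_powR _)).
exact: measurableT_comp measurable_enorm measurable_fst.
Qed.

Lemma measurable_ray_integral (F : 'rV[R]_n -> \bar R) :
  measurable_fun setT F -> (forall x, 0 <= F x) ->
  measurable_fun setT
    (fun x => \int[leb]_(r in `]0%R, 1%R[) (F (r *: dir x) * (r ^+ m)%:E)).
Proof.
move=> mF F0.
pose K (p : 'rV[R]_n * measurableTypeR R) : \bar R :=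
  if ((0 < p.2) && (p.2 < 1))%R then F (p.2 *: dir p.1) * (p.2 ^+ m)%:E else 0.
have mK : measurable_fun setT K.
  have msnd : measurable_fun setT (snd : 'rV[R]_n * measurableTypeR R -> measurableTypeR R).
    exact: measurable_snd.
  apply: measurable_fun_ifT => //.
    apply: measurable_and.
      exact: (@measurable_fun_ltr _ _ R _ (cst 0%R) snd).
    exact: (@measurable_fun_ltr _ _ R _ snd (cst 1%R)).
  apply: emeasurable_funM; first exact: measurableT_comp mF measurable_dir_pair.
  by apply/measurable_EFinP; apply: measurable_funX.
have K0 p : 0 <= K p.
  rewrite /K; case: ifP => // /andP[p0 _].
  by rewrite mule_ge0// lee_fin exprn_ge0// ltW.
have := measurable_fun_fubini_tonelli_F (m2 := leb) K mK K0.
apply: eq_measurable_fun => x _.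
rewrite [RHS]integral_mkcond; apply: eq_integral => r _.
by rewrite patchE mem_setE in_itv /= /K.
Qed.

Lemma ray_integral_finite_ae (F : 'rV[R]_n -> \bar R) :
  measurable_fun setT F -> (forall x, 0 <= F x) -> \int[lam]_(x in B) F x < +oo ->
  exists N, [/\ measurable N, lam N = 0 & forall x, C x -> ~ N x ->
    \int[leb]_(r in `]0%R, 1%R[) (F (r *: dir x) * (r ^+ m)%:E) < +oo].
Proof.
move=> mF F0 Foo; apply: integrable_ge0_finite_ae.
- exact: measurable_punctured_ball.
- by apply: measurable_funTS; exact: measurable_ray_integral.
- move=> x _; apply: integral_ge0 => r; rewrite /= in_itv /= => /andP[r0 _].
  by rewrite mule_ge0// lee_fin exprn_ge0// ltW.
- by rewrite polar_integral// lte_mul_pinfty// lee_fin.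
Qed.

(** By [polar_integral] the ray integrals have total at most 1/n over [C], and 1/n is
    [(omega R n)^-1] times the volume of [C]. The set [N] leaves room to ask for further properties
    of the ray that hold almost everywhere. *)
Lemma exists_ray_le_average (F : 'rV[R]_n -> \bar R) (N : set 'rV[R]_n) :
  measurable_fun setT F -> (forall x, 0 <= F x) -> \int[lam]_(x in B) F x <= 1 ->
  measurable N -> lam N = 0 -> exists x, [/\ C x, ~ N x &
    \int[leb]_(r in `]0%R, 1%R[) (F (r *: dir x) * (r ^+ m)%:E) <= ((omega R n)^-1)%:E].
Proof.
move=> mF F0 F1 mN N0; apply: (exists_le_average (mu := lam)) => //.
- exact: measurable_punctured_ball.
- by rewrite punctured_ball_gt0 punctured_ball_fin.
- by rewrite invr_ge0 ltW// omega_gt0.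
- by apply: measurable_funTS; exact: measurable_ray_integral.
- move=> x _; apply: integral_ge0 => r; rewrite /= in_itv /= => /andP[r0 _].
  by rewrite mule_ge0// lee_fin exprn_ge0// ltW.
- rewrite polar_integral//.
  have [c Ec] : exists c, lam C = c%:E.
    by exists (fine (lam C)); rewrite fineK// ge0_fin_numE// punctured_ball_fin.
  have c0 : (0 < c)%R by rewrite -lte_fin -Ec punctured_ball_gt0.
  have -> : omega R n = (n%:R * c)%R.
    by apply: EFin_inj; rewrite -omegaE Ec.
  rewrite -[X in _ <= _ * X]/(lam C) Ec -EFinM invfM mulfVK ?gt_eqF//.
  by rewrite -[leRHS]mule1 lee_wpmul2l// lee_fin.
Qed.

Lemma nneseries_fin_lt (T : nat -> \bar R) (eps : R) :
  (forall k, 0 <= T k) -> \sum_(k <oo) T k < +oo -> (0 < eps)%R ->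
  exists k, T k < eps%:E.
Proof.
move=> T0 Too eps0; apply: contrapT => H.
have {}H k : eps%:E <= T k by rewrite leNgt; apply/negP => Tk; apply: H; exists k.
suff : \sum_(k <oo) T k = +oo by move=> E; rewrite E ltxx in Too.
apply/eqyP => A A0.
apply: (@le_trans _ _ (\sum_(0 <= i < (Num.trunc (A / eps)).+1) T i)); last first.
  by apply: nneseries_lim_ge => i _ _; exact: T0.
apply: (@le_trans _ _ (\sum_(0 <= i < (Num.trunc (A / eps)).+1) eps%:E)); last first.
  by apply: lee_sum => i _; exact: H.
rewrite big_mkord sumEFin lee_fin sumr_const card_ord -mulr_natl.
by rewrite -ler_pdivrMr// ltW// truncnS_gt.
Qed.

End almost_every_ray.

(** * Passage to the limit along a single ray *)

Section radial_representative.
Context {R : realType} {m : nat}.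
Local Notation n := m.+1.
Local Notation leb := (@lebesgue_measure R).
Local Notation lam := (lebesgue_rV R n).
Local Notation C := (@punctured_ball R m).
Local Notation B := (@unit_ball R n).

Lemma measurable_enorm_comp d (T : measurableType d) (k : nat) (D : set T)
    (v : T -> 'rV[R]_k) :
  (forall i, measurable_fun D (fun x => v x 0 i : measurableTypeR R)) ->
  measurable_fun D (fun x => enorm (v x) : measurableTypeR R).
Proof.
move=> mv; apply: (@measurableT_comp _ _ _ _ _ _ (Num.sqrt : R -> R)).
  by apply: continuous_measurable_fun; exact: sqrt_continuous.
by apply: measurable_sum => i; apply: measurable_funX; exact: mv.
Qed.

(* The elementary substitute for Hoelder's inequality in passing from
   convergence in L^n to convergence in L^1 away from the origin. *)
Lemma le_eps_power (a eps t r : R) : 0 <= a -> 0 < eps -> 0 < r -> r <= t ->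
  a <= eps + (eps ^+ m * r ^+ m)^-1 * (a ^+ n * t ^+ m).
Proof.
move=> a0 e0 r0 rt.
have h0 : 0 <= (eps ^+ m * r ^+ m)^-1 * (a ^+ n * t ^+ m).
  have t0 := le_trans (ltW r0) rt.
  by rewrite mulr_ge0 ?invr_ge0// mulr_ge0// exprn_ge0// ltW.
have [ae|ea] := leP a eps; first by rewrite (le_trans ae)// lerDl.
apply: (@le_trans _ _ ((eps ^+ m * r ^+ m)^-1 * (a ^+ n * t ^+ m))); last by rewrite lerDr ltW.
rewrite ler_pdivlMl ?mulr_gt0 ?exprn_gt0// mulrC exprS -mulrA.
rewrite ler_wpM2l// ler_pM ?exprn_ge0 ?(ltW e0) ?(ltW r0)// lerXn2r ?nnegrE ?(ltW e0) ?(ltW r0)//.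
- exact: ltW.
- by rewrite (le_trans (ltW r0)).
Qed.

Local Open Scope ereal_scope.

Section fixed_ray.
Variables (u : 'rV[R]_n -> R) (G : 'rV[R]_n -> 'rV[R]_n).
Variable phi : nat -> 'rV[R]_n -> R.
Hypothesis test_phi : forall k, test_function B (phi k).
Hypothesis mu : measurable_fun setT (u : 'rV[R]_n -> measurableTypeR R).
Hypothesis mG : forall i, measurable_fun setT (fun x => G x 0%R i : measurableTypeR R).

Let F k x : R := (`|u x - phi k x| ^+ n + enorm (G x - grad (phi k) x) ^+ n)%R.

Let mphi k : measurable_fun setT (phi k : 'rV[R]_n -> measurableTypeR R).
Proof. by apply: continuous_measurable_rV; exact: continuous_test (test_phi k). Qed.

Let mgrad k : measurable_fun setT
  (fun x => enorm (G x - grad (phi k) x) : measurableTypeR R).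
Proof.
apply: measurable_enorm_comp => i.
rewrite (_ : (fun x => _) = (fun x => G x 0 i - partial i (phi k) x))%R; last first.
  by apply/funext => x; rewrite !mxE.
apply: measurable_funB; first exact: mG.
by apply: continuous_measurable_rV; exact: continuous_partial_test (test_phi k) i.
Qed.

Let mF k : measurable_fun setT (F k : 'rV[R]_n -> measurableTypeR R).
Proof.
apply: measurable_funD; last by apply: measurable_funX; exact: mgrad.
apply: measurable_funX.
apply: (@measurableT_comp _ _ _ _ _ _ (@Num.norm R R)); first exact: normr_measurable.
by apply: measurable_funB; [exact: mu|exact: mphi].
Qed.

Let F0 k x : (0 <= F k x)%R.
Proof. by rewrite addr_ge0// exprn_ge0// enorm_ge0. Qed.

(** Summability replaces convergence: where the series is finite, or has finite weighted integral
    along the ray, some term is as small as desired. *)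
Let S x : \bar R := \sum_(k <oo) (F k x)%:E.

Let mS : measurable_fun setT S.
Proof.
have := @ge0_emeasurable_sum _ _ R setT (fun k x => (F k x)%:E) xpredT.
apply => [k x _ _|k _]; first by rewrite lee_fin F0.
by apply/measurable_EFinP; exact: mF.
Qed.

Let S0 x : 0 <= S x.
Proof. by apply: nneseries_ge0 => k _ _; rewrite lee_fin F0. Qed.

Variable e : 'rV[R]_n.
Hypothesis e1 : enorm e = 1%R.
Hypothesis Sfin : \int[leb]_(r in `]0%R, 1%R[) (S (r *: e) * (r ^+ m)%:E) < +oo.

(** One sufficiently good index suffices instead of a limit: [u] is close to [phi k] at the point,
    [test_ray_le] bounds [phi k] by its gradient on the ray, and [le_eps_power] makes the gradient
    error small in L^1 on ]r, 1[, away from the origin. *)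
Lemma ray_limit_le (r : R) : (0 < r < 1)%R -> S (r *: e) < +oo ->
  `|u (r *: e)|%:E <= \int[leb]_(t in `]r, 1%R[) (enorm (G (t *: e)))%:E.
Proof.
move=> /andP[r0 r1] Sr.
pose I k := \int[leb]_(t in `]0%R, 1%R[) ((F k (t *: e) * t ^+ m)%:E).
have mray : measurable_fun setT (fun t : measurableTypeR R => t *: e) := measurable_ray e.
have mFr k (A : set (measurableTypeR R)) : measurable_fun A (fun t : measurableTypeR R => (F k (t *: e) * t ^+ m)%R : measurableTypeR R).
  apply: measurable_funTS; apply: measurable_funM; last exact: measurable_funX.
  exact: measurableT_comp (mF k) mray.
have Fr0 k t : (0 < t)%R -> (0 <= F k (t *: e) * t ^+ m)%R.
  by move=> t0; rewrite mulr_ge0// exprn_ge0// ltW.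
have I0 k : 0 <= I k.
  apply: integral_ge0 => t; rewrite /= in_itv /= => /andP[t0 _].
  by rewrite lee_fin Fr0.
have sumI : \sum_(k <oo) I k < +oo.
  rewrite -integral_nneseries//; last 2 first.
  - by move=> k; apply/measurable_EFinP; exact: mFr.
  - by move=> k t; rewrite /= in_itv /= => /andP[t0 _]; rewrite lee_fin Fr0.
  rewrite (eq_integral (fun t : measurableTypeR R => S (t *: e) * (t ^+ m)%:E))// => t.
  rewrite inE /= in_itv /= => /andP[t0 _].
  rewrite muleC -nneseriesZl//; last by move=> k _; rewrite lee_fin F0.
  by apply: eq_eseriesr => k _; rewrite -EFinM mulrC.
(* Adding the error at the point to the error along the ray makes the same [k] serve both
   estimates. *)
pose T k := (F k (r *: e))%:E + I k.
have T0 k : 0 <= T k by rewrite adde_ge0// lee_fin F0.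
have Tfin : \sum_(k <oo) T k < +oo.
  rewrite nneseriesD//; first exact: lte_add_pinfty.
  by move=> k _ _; rewrite lee_fin F0.
apply/lee_addgt0Pr => eps3 eps30.
(* One third for the distance from [u] to [phi k] at the point, two thirds for the gradient error
   [ale]. *)
pose eps := (eps3 / 3)%R.
have eps0 : (0 < eps)%R by rewrite divr_gt0.
have [k] := nneseries_fin_lt T0 Tfin
  (mulr_gt0 (exprn_gt0 n eps0) (exprn_gt0 m r0)).
(* Chosen so that [eta <= eps ^+ n], for the pointwise error, and so that [eta] times the factor
   [(eps ^+ m * r ^+ m)^-1] of [le_eps_power] is [eps]. *)
set eta := (eps ^+ n * r ^+ m)%R => Tk.
have Fk : (F k (r *: e) <= eta)%R.
  by rewrite -lee_fin (le_trans _ (ltW Tk))// leeDl.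
have Ik : I k <= eta%:E by rewrite (le_trans _ (ltW Tk))// leeDr// lee_fin F0.
have uphi : (`|u (r *: e) - phi k (r *: e)| <= eps)%R.
  rewrite -(@ler_pXn2r _ n)// ?nnegrE ?(ltW eps0)//.
  apply: (@le_trans _ _ (F k (r *: e))); first by rewrite lerDl exprn_ge0// enorm_ge0.
  by rewrite (le_trans Fk)// ger_pMr ?exprn_gt0// exprn_ile1// ?(ltW r0) ?(ltW r1).
have Be : ~ B e by rewrite /unit_ball /= e1 ltxx.
pose a t := enorm (G (t *: e) - grad (phi k) (t *: e)).
have ma (A : set (measurableTypeR R)) : measurable_fun A (a : measurableTypeR R -> measurableTypeR R).
  by apply: measurable_funTS; exact: measurableT_comp (mgrad k) mray.
have mGr (A : set (measurableTypeR R)) : measurable_fun A (fun t : measurableTypeR R => enorm (G (t *: e)) : measurableTypeR R).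
  apply: measurable_funTS; apply: measurable_enorm_comp => i.
  exact: measurableT_comp (mG i) mray.
have mD (A : set (measurableTypeR R)) : measurable_fun A (fun t : measurableTypeR R =>
    (\sum_i e 0 i * partial i (phi k) (t *: e))%R : measurableTypeR R).
  apply: measurable_funTS; apply: continuous_measurable_fun.
  exact: continuous_radial_derivative (test_phi k) e.
have phile : `|phi k (r *: e)|%:E <=
    \int[leb]_(t in `]r, 1%R[) (enorm (G (t *: e)))%:E +
    \int[leb]_(t in `]r, 1%R[) (a t)%:E.
  apply: (le_trans (test_ray_le (test_phi k) r1 Be)).
  rewrite -ge0_integralD//; last 4 first.
  - by move=> t _; rewrite lee_fin enorm_ge0.
  - by apply/measurable_EFinP; exact: mGr.
  - by move=> t _; rewrite lee_fin enorm_ge0.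
  - by apply/measurable_EFinP; exact: ma.
  apply: ge0_le_integral => //.
  - by apply/measurable_EFinP; apply: measurableT_comp => //; exact: mD.
  - by apply: emeasurable_funD; apply/measurable_EFinP; [exact: mGr|exact: ma].
  move=> t _; rewrite -EFinD lee_fin.
  rewrite [X in (`|X| <= _)%R](_ : _ = (\sum_i e 0 i * G (t *: e) 0 i) -
    (\sum_i e 0 i * (G (t *: e) - grad (phi k) (t *: e)) 0 i))%R; last first.
    by rewrite -sumrB; apply: eq_bigr => i _; rewrite !mxE; ring.
  apply: (le_trans (ler_normB _ _)).
  by apply: lerD; exact: Cauchy_Schwarz_unit.
have ale : \int[leb]_(t in `]r, 1%R[) (a t)%:E <= (eps + eps)%:E.
  pose c := ((eps ^+ m * r ^+ m)^-1)%R.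
  have c0 : (0 <= c)%R by rewrite invr_ge0 mulr_ge0// exprn_ge0// ltW.
  apply: (@le_trans _ _ (\int[leb]_(t in `]r, 1%R[) (cst eps%:E t + c%:E * (F k (t *: e) * t ^+ m)%:E))).
    apply: ge0_le_integral => //.
    - by move=> t _; rewrite lee_fin enorm_ge0.
    - by apply/measurable_EFinP; exact: ma.
    - apply: emeasurable_funD => //; apply: emeasurable_funM => //.
      by apply/measurable_EFinP; exact: mFr.
    move=> t; rewrite /= in_itv /= => /andP[rt _].
    rewrite -EFinM -EFinD lee_fin.
    apply: (le_trans (le_eps_power (enorm_ge0 _) eps0 r0 (ltW rt))).
    rewrite lerD2l ler_wpM2l// ler_wpM2r ?exprn_ge0 ?(ltW (lt_trans r0 rt))//.
    by rewrite /F lerDr exprn_ge0.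
  have tr0 t : `]r, 1%R[%classic t -> (0 < t)%R.
    by rewrite /= in_itv /= => /andP[rt _]; exact: lt_trans r0 rt.
  rewrite ge0_integralD//; last 3 first.
  - by move=> t _; rewrite lee_fin ltW.
  - by move=> t /tr0 t0; rewrite mule_ge0// lee_fin// Fr0.
  - by apply: emeasurable_funM => //; apply/measurable_EFinP; exact: mFr.
  rewrite EFinD; apply: leeD.
    rewrite integral_cst// -[X in _ * X <= _]/(leb `]r, 1%R[) lebesgue_measure_itv /= lte_fin r1 -EFinD -EFinM lee_fin.
    by rewrite ger_pMr// gerBl ltW.
  rewrite ge0_integralZl//; last 2 first.
  - by apply/measurable_EFinP; exact: mFr.
  - by move=> t /tr0 t0; rewrite lee_fin Fr0.
  apply: (@le_trans _ _ (c%:E * I k)).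
    rewrite lee_wpmul2l ?lee_fin//; apply: ge0_subset_integral => //.
    - by apply/measurable_EFinP; exact: mFr.
    - by move=> t; rewrite /= in_itv /= => /andP[t0 _]; rewrite lee_fin Fr0.
    - by apply: subset_itvr; rewrite bnd_simp ltW.
  apply: (@le_trans _ _ (c%:E * eta%:E)); first by rewrite lee_wpmul2l ?lee_fin.
  rewrite -EFinM lee_fin /c /eta exprSr [(_ * eps * _)%R]mulrAC.
  by rewrite mulKf// mulf_neq0// expf_neq0// gt_eqF.
have -> : eps3 = (eps + (eps + eps))%R by rewrite /eps; field.
apply: (@le_trans _ _ (eps%:E + `|phi k (r *: e)|%:E)).
  rewrite -EFinD lee_fin -[X in (`|X| <= _)%R](subrK (phi k (r *: e))).
  by apply: (le_trans (ler_normD _ _)); rewrite lerD2r.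
rewrite EFinD addeCA; apply: leeD => //.
by apply: (le_trans phile); apply: leeD.
Qed.

End fixed_ray.
End radial_representative.

(** * The one-dimensional profile of a radial Sobolev function *)

Section radial_profile.
Context {R : realType} {m : nat}.
Local Notation n := m.+1.
Local Notation leb := (@lebesgue_measure R).
Local Notation lam := (lebesgue_rV R n).
Local Notation C := (@punctured_ball R m).
Local Notation B := (@unit_ball R n).

Lemma measurable_extend0 d (T : measurableType d) (D : set T) (f : T -> R) :
  measurable D -> measurable_fun D (f : T -> measurableTypeR R) ->
  measurable_fun setT (fun x => if x \in D then f x else 0 : measurableTypeR R).
Proof. by move=> mD mf; exact: ((measurable_restrictT f mD).1 mf). Qed.

Local Open Scope ereal_scope.

Lemma radial_profile (u : 'rV[R]_n -> R) : @unit_energy R n u ->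
  exists f : R -> R, [/\
    measurable_fun setT (f : measurableTypeR R -> measurableTypeR R),
    forall r, (0 <= f r)%R,
    \int[leb]_(r in `]0%R, 1%R[) (f r ^+ n * r ^+ m)%:E <= ((omega R n)^-1)%:E &
    exists N : set 'rV[R]_n, [/\ measurable N, lam N = 0 &
      forall x, B x -> ~ N x -> (0 < enorm x)%R /\
        `|u x|%:E <= \int[leb]_(t in `]enorm x, 1%R[) (f t)%:E]].
Proof.
move=> [G0 [[[[mu0 _] mG0 _] approx] [g [N [mN N0 subN]]]] energy].
have eqle (a b : \bar R) : a = b -> a <= b by move=> ->.
have mB : measurable B by exact: measurable_unit_ball.
(* Measurability is given on the ball only; cutting [u] and its gradient to 0 outside makes them
   measurable everywhere. *)
pose u1 x := if x \in B then u x else 0%R.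
pose G x := if x \in B then G0 x else 0%R.
have mu1 : measurable_fun setT (u1 : _ -> measurableTypeR R).
  exact: measurable_extend0.
have mG i : measurable_fun setT (fun x => G x 0%R i : measurableTypeR R).
  have [mGi _] := mG0 i.
  apply: eq_measurable_fun (measurable_extend0 mB mGi) => x _.
  by rewrite /G; case: ifP => //; rewrite mxE.
(* Errors below 2^-(k+1) sum to at most 1, which makes [S] integrable on the ball. *)
have := choice (fun k : nat => _ : exists phi, test_function B phi /\
  (\int[lam]_(x in B) (`|u x - phi x| ^+ n)%:E +
   \int[lam]_(x in B) (enorm (G0 x - grad phi x) ^+ n)%:E <
   (1 / (2 ^ k.+1)%:R)%:E)).
case.
  move=> k; have [|phi tphi H] := approx (1 / (2 ^ k.+1)%:R)%R.
    by rewrite divr_gt0// ltr0n expn_gt0.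
  by exists phi.
move=> phi phiP.
have tphi k : test_function B (phi k) by have [] := phiP k.
pose F k x : R := (`|u1 x - phi k x| ^+ n + enorm (G x - grad (phi k) x) ^+ n)%R.
have mphi k : measurable_fun setT (phi k : 'rV[R]_n -> measurableTypeR R).
  by apply: continuous_measurable_rV; exact: continuous_test (tphi k).
have mdu k : measurable_fun setT (fun x => `|u1 x - phi k x| ^+ n : measurableTypeR R)%R.
  apply: measurable_funX.
  apply: (@measurableT_comp _ _ _ _ _ _ (@Num.norm R R)); first exact: normr_measurable.
  by apply: measurable_funB; [exact: mu1|exact: mphi].
have mdG k : measurable_fun setT
    (fun x => enorm (G x - grad (phi k) x) ^+ n : measurableTypeR R)%R.
  apply: measurable_funX; apply: measurable_enorm_comp => i.
  rewrite (_ : (fun x => _) = (fun x => G x 0 i - partial i (phi k) x))%R; last first.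
    by apply/funext => x; rewrite !mxE.
  apply: measurable_funB; first exact: mG.
  by apply: continuous_measurable_rV; exact: continuous_partial_test (tphi k) i.
have F0 k x : (0 <= F k x)%R by rewrite addr_ge0// exprn_ge0// enorm_ge0.
have mF k : measurable_fun setT (fun x => (F k x)%:E).
  by apply/measurable_EFinP; apply: measurable_funD; [exact: mdu|exact: mdG].
pose S x := \sum_(k <oo) (F k x)%:E.
have S0 x : 0 <= S x by apply: nneseries_ge0 => k _ _; rewrite lee_fin F0.
have mS : measurable_fun setT S.
  have := @ge0_emeasurable_sum _ _ R setT (fun k x => (F k x)%:E) xpredT.
  by apply => [k x _ _|k _]; [rewrite lee_fin F0|exact: mF].
have IS : \int[lam]_(x in B) S x < +oo.
  rewrite integral_nneseries//; last 2 first.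
  - by move=> k; apply: measurable_funTS; exact: mF.
  - by move=> k x _; rewrite lee_fin F0.
  apply: (@le_lt_trans _ _ 1%:E); last by rewrite ltry.
  have := @epsilon_trick R (fun=> 0) 1%R xpredT (fun=> lexx 0) ler01.
  rewrite [X in _ <= X + _](_ : _ = 0); last by rewrite eseries0.
  rewrite add0e; apply: le_trans.
  apply: lee_nneseries => [k _ _|k _].
    by apply: integral_ge0 => x _; rewrite lee_fin F0.
  rewrite add0e; apply: le_trans (ltW (phiP k).2).
  rewrite (eq_integral (fun x => (`|u1 x - phi k x| ^+ n)%:E +
    (enorm (G x - grad (phi k) x) ^+ n)%:E))//.
  rewrite ge0_integralD//; last 3 first.
  - by apply/measurable_EFinP; apply: measurable_funTS; exact: mdu.
  - by move=> x _; rewrite lee_fin exprn_ge0// enorm_ge0.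
  - by apply/measurable_EFinP; apply: measurable_funTS; exact: mdG.
  by apply: leeD; apply: eqle; apply: eq_integral => x xB;
    rewrite /u1 /G xB.
(* [N] is the null set outside which [u] is a function of the norm. Finiteness of [H] at a point
   says at once that the approximation series converges there and that the point is not in [N]. *)
pose H x := S x + ((cst +oo) \_ N) x.
have mH : measurable_fun setT H.
  apply: emeasurable_funD => //.
  exact: ((measurable_restrictT (cst +oo) mN).1 (measurable_cst _)).
have oo0 x : 0 <= ((cst +oo : 'rV[R]_n -> \bar R) \_ N) x.
  by rewrite patchE; case: ifP => _; [exact: le0y|exact: lexx].
have H0 x : 0 <= H x by rewrite adde_ge0.
have IH : \int[lam]_(x in B) H x < +oo.
  rewrite (@ge0_ae_eq_integral _ _ _ _ _ H S)//; try exact: measurable_funTS.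
  exists N; split => // x /= Hx; apply: contrapT => Nx; apply: Hx => _.
  by rewrite /H patchE memNset// adde0.
have [M [mM M0 finM]] := ray_integral_finite_ae mH H0 IH.
pose E x := (enorm (G x) ^+ n)%:E.
have mE : measurable_fun setT E.
  apply/measurable_EFinP; apply: measurable_funX.
  by apply: measurable_enorm_comp; exact: mG.
have E0 x : 0 <= E x by rewrite lee_fin exprn_ge0// enorm_ge0.
have IE : \int[lam]_(x in B) E x <= 1.
  apply: le_trans energy; apply: eqle.
  by apply: eq_integral => x xB; rewrite /E /G xB.
(* The direction is picked outside [M], so the same ray has at most the average energy and a finite
   integral of [H]. *)
have [x0 [/[dup] Cx0 /andP[x00 _] Mx0 Ele]] := exists_ray_le_average mE E0 IE mM M0.
pose e := dir x0.
have e1 : enorm e = 1%R by exact: enorm_dir.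
have mray : measurable_fun setT (fun t : measurableTypeR R => t *: e) := measurable_ray e.
have IHr := finM _ Cx0 Mx0; rewrite -/e in IHr Ele.
have pow0 r : (0 <= r)%R -> 0 <= (r ^+ m)%:E by move=> r0; rewrite lee_fin exprn_ge0.
have mpow (A : set (measurableTypeR R)) : measurable_fun A (fun r : measurableTypeR R => (r ^+ m)%:E).
  by apply/measurable_EFinP; apply: measurable_funX.
have mSr (A : set (measurableTypeR R)) :
    measurable_fun A (fun r : measurableTypeR R => S (r *: e)).
  by apply: measurable_funTS; exact: (measurableT_comp mS mray).
have mHr (A : set (measurableTypeR R)) :
    measurable_fun A (fun r : measurableTypeR R => H (r *: e)).
  by apply: measurable_funTS; exact: (measurableT_comp mH mray).
have Sfin : \int[leb]_(r in `]0%R, 1%R[) (S (r *: e) * (r ^+ m)%:E) < +oo.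
  apply: le_lt_trans IHr; apply: ge0_le_integral => //.
  - by move=> r; rewrite /= in_itv /= => /andP[/ltW r0 _]; rewrite mule_ge0// pow0.
  - by apply: emeasurable_funM; [exact: mSr|exact: mpow].
  - by apply: emeasurable_funM; [exact: mHr|exact: mpow].
  - move=> r; rewrite /= in_itv /= => /andP[/ltW r0 _].
    by rewrite lee_wpmul2r ?pow0// leeDl.
have [N1 [mN1 N10 finN1]] : exists N1, [/\ measurable N1, leb N1 = 0 &
    forall r, `]0%R, 1%R[%classic r -> ~ N1 r -> H (r *: e) * (r ^+ m)%:E < +oo].
  apply: integrable_ge0_finite_ae => //.
  - by apply: emeasurable_funM; [exact: mHr|exact: mpow].
  - by move=> r; rewrite /= in_itv /= => /andP[/ltW r0 _]; rewrite mule_ge0// pow0.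
exists (fun t => enorm (G (t *: e))); split.
- by apply: measurable_enorm_comp => i; exact: measurableT_comp (mG i) mray.
- by move=> r; exact: enorm_ge0.
- by under eq_integral do rewrite EFinM.
(* Points are discarded for three reasons: the symmetry of [u] fails at the point itself, the chosen
   ray is bad at the same radius, or the point is the origin. *)
pose N2 := B `&` @enorm R n @^-1` N1.
have mN2 : measurable N2.
  apply: measurableI => //; rewrite -[X in measurable X]setTI.
  exact: measurable_enorm.
exists (N `|` N2 `|` [set (0%R : 'rV[R]_n)]); split.
- by apply: measurableU; [exact: measurableU|exact: measurable_rV0].
- apply/eqP; rewrite eq_le measure_ge0 andbT.
  apply: (le_trans (measureU2 _ _ _)); [exact: measurableU|exact: measurable_rV0|].
  rewrite -[X in _ + X]/(lam [set (0%R : 'rV[R]_n)]) lebesgue_rV0 adde0.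
  apply: (le_trans (measureU2 _ _ _)) => //.
  rewrite -[X in X + _]/(lam N) -[X in _ + X]/(lam N2) N0 add0e.
  by rewrite /N2 radial_negligible.
move=> x Bx Nx.
have x_gt0 : (0 < enorm x)%R.
  rewrite lt_neqAle enorm_ge0 andbT eq_sym enorm_eq0; apply/eqP => x_0.
  by apply: Nx; right.
split => //.
have x1 : (enorm x < 1)%R by [].
have r01 : `]0%R, 1%R[%classic (enorm x) by rewrite /= in_itv /= x_gt0.
have N1x : ~ N1 (enorm x) by move=> N1x; apply: Nx; left; right.
have Hfin : H (enorm x *: e) < +oo.
  rewrite ltey; apply/eqP => Hoo; have := finN1 _ r01 N1x.
  by rewrite Hoo gt0_mulye ?ltxx// lte_fin exprn_gt0.
have NR : ~ N (enorm x *: e).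
  by move=> Nr; move: Hfin; rewrite /H patchE mem_set//= addey// gt_eqF// (lt_le_trans ltNy0).
have Bxe : B (enorm x *: e).
  by rewrite /unit_ball /= enormZ e1 mulr1 gtr0_norm.
have ug y : B y -> ~ N y -> u y = g (enorm y).
  by move=> By Ny; apply: contrapT => uy; apply: Ny; apply: subN => /= /(_ By).
have -> : u x = u1 (enorm x *: e).
  rewrite /u1 mem_set// ug// ?(ug (enorm x *: e))//; last first.
    by move=> Nx'; apply: Nx; left; left.
  by rewrite enormZ e1 mulr1 gtr0_norm.
apply: (ray_limit_le tphi mu1 mG e1 Sfin); first by rewrite x_gt0.
by apply: le_lt_trans Hfin; rewrite leeDl.
Qed.

End radial_profile.

(** * Moser's inequality *)

Section moser_pair.
Context {R : realType}.

Lemma bernoulli_sub (m : nat) (x : R) : 0 <= x <= 1 -> 1 - m%:R * x <= (1 - x) ^+ m.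
Proof.
move=> /andP[x0 x1]; elim: m => [|m IH]; first by rewrite mul0r subr0 expr0.
rewrite exprS; have x1' : 0 <= 1 - x by rewrite subr_ge0.
apply: (@le_trans _ _ ((1 - x) * (1 - m%:R * x))); last exact: ler_wpM2l.
have h : 0 <= m%:R * x ^+ 2 by rewrite mulr_ge0// sqr_ge0.
rewrite -natr1; lra.
Qed.

(** The exponent n/(n-1) becomes an integer after raising to the power [m]; comparisons with the
    energy are made in this form. *)
Lemma powR_exp_ratio (m : nat) (x : R) : (0 < m)%N -> 0 <= x ->
  (x `^ (m.+1%:R / m%:R)) ^+ m = x ^+ m.+1.
Proof.
move=> m0 x0; rewrite -powR_mulrn ?powR_ge0// -powRrM divfK ?powR_mulrn//.
by rewrite pnatr_eq0 -lt0n.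
Qed.

(* Jensen's inequality for [x |-> x `^ q] at the points [x / (1 - th)] and
   [z / th] with weights [1 - th] and [th]. *)
Lemma powR_add_le (q x z th : R) : 1 <= q -> 0 <= x -> 0 <= z -> 0 < th < 1 ->
  (x + z) `^ q <= (1 - th) `^ (1 - q) * x `^ q + th `^ (1 - q) * z `^ q.
Proof.
move=> q1 x0 z0 /andP[th0 th1].
have th1' : 0 < 1 - th by rewrite subr_gt0.
have key (c y : R) : 0 < c -> 0 <= y -> c * (y / c) `^ q = c `^ (1 - q) * y `^ q.
  move=> c0 y0; rewrite powRM ?invr_ge0 ?(ltW c0)//.
  rewrite -[c^-1]powR_inv1 ?ltW// -powRrM mulN1r.
  rewrite -[X in X * _](powRr1 (ltW c0)) mulrCA -powRD; last first.
    by apply/implyP => _; rewrite gt_eqF.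
  by rewrite mulrC.
have := @convex_powR R q q1 (Itv01 (ltW th1') (ltac:(by rewrite gerBl ltW))) (x / (1 - th)) (z / th).
rewrite !inE /= !in_itv /= !andbT.
move=> /(_ (divr_ge0 x0 (ltW th1')) (divr_ge0 z0 (ltW th0))).
move=> H; rewrite convRE [X in X `^ _ <= _]convRE /= in H.
move: H; have -> : unstable.onem (1 - th) = th by rewrite /unstable.onem opprB addrC subrK.
have E (c y : R) : 0 < c -> c * (y / c) = y by move=> c0; rewrite mulrC divfK// gt_eqF.
by rewrite !key// !E.
Qed.

(** Here [t] and [t + D] are the values of T at two points of one level set, [x] and [x + z] the
    values of the profile, and [e1], [e2] the fractions of energy spent up to the first point and
    between the two. As X = a x^q is at least t - lam, Bernoulli gives e1 >= 1 - m lam / t, so e2 <=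
    m lam / t. The increment then contributes at most D / 2 to the convexity bound, and the other D
    / 2 is controlled by [lam]. *)
Lemma moser_pair (m : nat) (a x z t D lam e1 e2 : R) : (0 < m)%N ->
  let q := m.+1%:R / m%:R in
  0 < a -> 0 <= x -> 0 <= z -> 0 <= D -> 0 < lam -> 0 <= e1 -> 0 <= e2 ->
  e1 + e2 <= 1 ->
  a ^+ m * x ^+ m.+1 <= e1 * t ^+ m -> a ^+ m * z ^+ m.+1 <= e2 * D ^+ m ->
  t - lam <= a * x `^ q -> t + D - lam <= a * (x + z) `^ q ->
  2 ^+ m.+1 * m%:R * lam <= t -> D <= (2 + 2 ^+ m.+2 * m%:R) * lam.
Proof.
move=> m0 q a0 x0 z0 D0 lam0 e10 e20 e12 Hx Hz tx tz tlam.
have mR : 0 < m%:R :> R by rewrite ltr0n.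
have m1 : 1 <= m%:R :> R by rewrite ler1n.
have two : 1 <= 2 ^+ m.+1 :> R by rewrite exprn_ege1// ler1n.
have lamt : lam <= t.
  apply: le_trans tlam; apply: ler_peMl; first exact: ltW.
  exact: mulr_ege1.
have t0 : 0 < t by apply: lt_le_trans lamt.
have q1E : 1 - q = - m%:R^-1.
  by rewrite /q -natr1; field; rewrite gt_eqF.
have q1 : 1 <= q by rewrite -subr_le0 q1E oppr_le0 invr_ge0 ltW.
(* As [1 - q] is -1/m, this weight is 2^m times the bound on [e2], which is what makes the term in
   [Z] at most D / 2. The assumed lower bound on [t] says precisely that [th <= 2^-1]. *)
pose th := 2 ^+ m * (m%:R * (lam / t)).
have th0 : 0 < th by rewrite !mulr_gt0// ?exprn_gt0// invr_gt0.
have th12 : th <= 2^-1.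
  rewrite /th !mulrA ler_pdivrMr// ler_pdivlMl// !mulrA -exprS.
  by [].
have th1 : 0 < th < 1 by rewrite th0 /=; lra.
pose X := a * x `^ q; pose Z := a * z `^ q.
have X0 : 0 <= X by rewrite mulr_ge0 ?powR_ge0// ltW.
have Z0 : 0 <= Z by rewrite mulr_ge0 ?powR_ge0// ltW.
have Xm : X ^+ m <= e1 * t ^+ m by rewrite exprMn powR_exp_ratio.
have Zm : Z ^+ m <= e2 * D ^+ m by rewrite exprMn powR_exp_ratio.
have Xt : X <= t.
  rewrite -(@ler_pXn2r _ m)// ?nnegrE// ?(ltW t0)//.
  apply: (le_trans Xm); rewrite ler_piMl ?exprn_ge0 ?(ltW t0)//; lra.
have e2d : e2 <= m%:R * (lam / t).
  have lt01 : 0 <= lam / t <= 1.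
    by rewrite divr_ge0 ?(ltW lam0) ?(ltW t0)//= ler_pdivrMr// mul1r.
  have := bernoulli_sub m lt01 => B.
  have : (1 - lam / t) ^+ m <= e1.
    rewrite -(@ler_pM2r _ (t ^+ m)) ?exprn_gt0// -exprMn.
    rewrite [X in X ^+ _ <= _](_ : _ = t - lam); last by field; rewrite gt_eqF.
    apply: le_trans Xm; apply: lerXn2r; rewrite ?nnegrE ?subr_ge0//.
  lra.
have Zhalf : th `^ (1 - q) * Z <= D / 2.
  rewrite -(@ler_pXn2r _ m)// ?nnegrE ?mulr_ge0 ?powR_ge0 ?divr_ge0 ?(ltW a0)//.
  rewrite exprMn q1E -powR_mulrn ?powR_ge0// -powRrM mulNr mulVf ?gt_eqF//.
  rewrite powR_inv1 ?(ltW th0)// ler_pdivrMl//.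
  apply: (le_trans Zm); rewrite expr_div_n.
  apply: (@le_trans _ _ (m%:R * (lam / t) * D ^+ m)).
    by rewrite ler_wpM2r// exprn_ge0.
  have E (y c d : R) : y != 0 -> y * c * (d / y) = c * d.
    by move=> y0; field.
  by rewrite /th E// expf_neq0// pnatr_eq0.
(* The power is at most (1 - th)^(-1), which is at most 1 + 2 th because th <= 1/2. The excess 2 th
   X is of order [lam], since X <= t. *)
have Xle : (1 - th) `^ (1 - q) * X <= (1 + 2 * th) * X.
  apply: ler_wpM2r => //; rewrite q1E powRN.
  have s0 : 0 < 1 - th by lra.
  apply: (@le_trans _ _ ((1 - th)^-1)).
    rewrite lef_pV2 ?posrE ?powR_gt0//.
    by apply: ger1_powR; [rewrite s0 gerBl ltW|rewrite invf_le1].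
  rewrite -[leLHS]mul1r ler_pdivrMr//; nra.
have := powR_add_le q1 x0 z0 th1; rewrite -(ler_pM2l a0) mulrDr.
rewrite mulrCA -/X [a * (th `^ _ * _)]mulrCA -/Z => conv.
have thX : th * X <= 2 ^+ m * m%:R * lam.
  apply: (@le_trans _ _ (th * t)); first by rewrite ler_wpM2l// ltW.
  by rewrite /th !mulrA mulfVK// gt_eqF.
move: thX; set y := 2 ^+ m * m%:R * lam => thX.
have E : (2 + 2 ^+ m.+2 * m%:R) * lam = 2 * lam + 4 * y.
  by rewrite /y !exprS; ring.
suff H : D <= 2 * lam + 4 * y by apply: (le_trans H); rewrite -E; exact: lexx.
have : (1 + 2 * th) * X <= t + 2 * y by rewrite mulrDl mul1r -mulrA; lra.
lra.
Qed.

End moser_pair.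

(** * Hoelder's inequality for increments of the profile *)

Section profile.
Context {R : realType} {m : nat}.
Local Notation n := m.+1.
Local Notation leb := (@lebesgue_measure R).

(* With [x = f t * t], dividing by [t] and integrating gives Hoelder's inequality
   [increment_power] once [c] is optimized. *)
Lemma power_tangent (x c : R) : 0 <= x -> 0 <= c ->
  n%:R * c ^+ m * x <= x ^+ n + m%:R * c ^+ n.
Proof.
move=> x0 c0; elim: m => [|k IH]; first by rewrite !expr1 expr0; lra.
have : x * (k.+1%:R * c ^+ k * x) <= x * (x ^+ k.+1 + k%:R * c ^+ k.+1) by exact: ler_wpM2l.
have : 0 <= k.+1%:R * c ^+ k * (c - x) ^+ 2.
  by apply: mulr_ge0; [rewrite mulr_ge0// exprn_ge0|exact: sqr_ge0].
rewrite -[k.+2%:R]natr1 -[k.+1%:R]natr1 !exprS expr0.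
move: (c ^+ k) (x ^+ k) => y z; lra.
Qed.

Lemma integral_inv (s r : R) : 0 < s -> s <= r ->
  (\int[leb]_(t in `[s, r]) (t^-1)%:E = (ln r - ln s)%:E)%E.
Proof.
move=> s0; rewrite le_eqVlt => /predU1P[<-|sr].
  by rewrite set_itv1 integral_set1 subrr.
have pos t : t \in `[s, r] -> 0 < t.
  by rewrite in_itv /= => /andP[st _]; exact: lt_le_trans st.
rewrite (@continuous_FTC2 _ (fun t : R => t^-1) (@ln R) s r sr) ?EFinB//.
- apply: continuous_in_subspaceT => t; rewrite inE => /pos t0.
  by apply: inv_continuous; rewrite gt_eqF.
- split.
  + move=> t; rewrite in_itv /= => /andP[st _].
    by have [] := is_derive1_ln (lt_trans s0 st).
  + by apply: cvg_at_right_filter; exact: continuous_ln.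
  + by apply: cvg_at_left_filter; apply: continuous_ln; exact: lt_trans sr.
- move=> t; rewrite in_itv /= => /andP[st _].
  by have [_] := is_derive1_ln (lt_trans s0 st); rewrite derive1E.
Qed.

Variables (f : R -> R) (om : R).
Hypothesis mf : measurable_fun setT (f : measurableTypeR R -> measurableTypeR R).
Hypothesis f0 : forall r, 0 <= f r.
Hypothesis om0 : 0 < om.
Hypothesis energy_le :
  (\int[leb]_(r in `]0%R, 1%R[) (f r ^+ n * r ^+ m)%:E <= (om^-1)%:E)%E.

Let A s r := (\int[leb]_(t in `]s, r[) (f t)%:E)%E.
Let E s r := (\int[leb]_(t in `]s, r[) (f t ^+ n * t ^+ m)%:E)%E.

Let mfE (D : set (measurableTypeR R)) : measurable_fun D (fun t => (f t)%:E).
Proof. by apply/measurable_EFinP; exact: measurable_funTS. Qed.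

Let mpE (D : set (measurableTypeR R)) :
  measurable_fun D (fun t : measurableTypeR R => (f t ^+ n * t ^+ m)%:E).
Proof.
apply/measurable_EFinP; apply: measurable_funTS; apply: measurable_funM.
  exact: measurable_funX.
exact: measurable_funX.
Qed.

Let p0 t : 0 < t -> 0 <= f t ^+ n * t ^+ m.
Proof. by move=> t0; rewrite mulr_ge0// exprn_ge0// ltW. Qed.

Let E_ge0 s r : 0 < s -> (0 <= E s r)%E.
Proof.
move=> s0; apply: integral_ge0 => t; rewrite /= in_itv /= => /andP[st _].
by rewrite lee_fin p0// (lt_trans s0).
Qed.

Lemma energy_split s r : 0 < s -> s < r -> r < 1 ->
  (E s r + E r 1%R <= (om^-1)%:E)%E.
Proof.
move=> s0 sr r1; apply: le_trans energy_le.
have r0 := lt_trans s0 sr.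
rewrite /E -ge0_integral_setU//=.
- apply: ge0_subset_integral => //.
  + exact: measurableU.
  + by move=> t; rewrite /= in_itv /= => /andP[t0 _]; rewrite lee_fin p0.
  + move=> t /= []; rewrite !in_itv /= => /andP[h1 h2].
      by rewrite (lt_trans s0 h1) (lt_trans h2 r1).
    by rewrite (lt_trans r0 h1) h2.
- move=> t /= []; rewrite in_itv /= => /andP[h1 h2]; rewrite lee_fin p0//.
    exact: lt_trans h1.
  exact: lt_trans h1.
- apply/disj_setPS => t /= [] /=; rewrite !in_itv /= => /andP[_ h1] /andP[h2 _].
  by have := lt_trans h1 h2; rewrite ltxx.
Qed.

Lemma energy_fin s r : 0 < s -> s < r -> r <= 1 -> E s r \is a fin_num.
Proof.
move=> s0 sr r1; rewrite ge0_fin_numE ?E_ge0//.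
apply: (@le_lt_trans _ _ (om^-1)%:E); last by rewrite ltry.
apply: le_trans energy_le; apply: ge0_subset_integral => //.
- by move=> t; rewrite /= in_itv /= => /andP[t0 _]; rewrite lee_fin p0.
- move=> t; rewrite /= !in_itv /= => /andP[h1 h2].
  by rewrite (lt_trans s0 h1) (lt_le_trans h2 r1).
Qed.

Lemma increment_linear s r c : 0 < s -> s < r -> 0 <= c ->
  ((n%:R * c ^+ m)%:E * A s r <= E s r + (m%:R * c ^+ n * (ln r - ln s))%:E)%E.
Proof.
move=> s0 sr c0.
have tpos t : `]s, r[%classic t -> 0 < t.
  by rewrite /= in_itv /= => /andP[st _]; exact: lt_trans st.
have minv : measurable_fun (`]s, r[ : set (measurableTypeR R)) (fun t : measurableTypeR R => (t^-1)%:E).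
  apply/measurable_EFinP; apply: (eq_measurable_fun (fun t : R => t `^ (-1))).
    by move=> t; rewrite inE => /tpos t0; rewrite powR_inv1// ltW.
  by apply: measurable_funTS; exact: measurable_powR.
have mc0 : 0 <= m%:R * c ^+ n by rewrite mulr_ge0// exprn_ge0.
rewrite [X in (_ <= _ + X)%E]EFinM -(integral_inv s0 (ltW sr)) integral_itv_bndoo//.
rewrite /A /E -!ge0_integralZl//; last 3 first.
- by move=> t /tpos t0; rewrite lee_fin invr_ge0 ltW.
- by move=> t _; rewrite lee_fin.
- by rewrite lee_fin mulr_ge0// exprn_ge0.
rewrite -ge0_integralD//; last 3 first.
- by move=> t /tpos t0; rewrite lee_fin p0.
- by move=> t /tpos t0; rewrite mule_ge0// lee_fin// invr_ge0 ltW.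
- exact: emeasurable_funM.
apply: ge0_le_integral => //.
- by move=> t _; rewrite mule_ge0// lee_fin// mulr_ge0// exprn_ge0.
- exact: emeasurable_funM.
- by apply: emeasurable_funD => //; exact: emeasurable_funM.
move=> t /tpos t0; rewrite -!EFinM -EFinD lee_fin.
have ti : 0 <= t^-1 by rewrite invr_ge0 ltW.
have := ler_wpM2r ti (power_tangent (mulr_ge0 (f0 t) (ltW t0)) c0).
have t0' : t != 0 by rewrite gt_eqF.
rewrite mulrA mulfK// => /le_trans; apply.
by rewrite mulrDl exprMn [t ^+ n]exprSr mulrA mulfK.
Qed.

(** The case c = 1 of [increment_linear] bounds the increment by the energy plus a logarithm. *)
Lemma increment_fin s r : 0 < s -> s < r -> r <= 1 -> A s r \is a fin_num.
Proof.
move=> s0 sr r1; have A0 : (0 <= A s r)%E.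
  by apply: integral_ge0 => t _; rewrite lee_fin.
rewrite ge0_fin_numE//.
have := increment_linear s0 sr ler01; rewrite !expr1n !mulr1.
have := energy_fin s0 sr r1.
case: (E s r) => [e _||]// H.
rewrite ltey; apply/eqP => Aoo; move: H; rewrite Aoo gt0_muley ?lte_fin//.
Qed.

Lemma increment_power s r : 0 < s -> s < r -> r <= 1 ->
  fine (A s r) ^+ n <= fine (E s r) * (ln r - ln s) ^+ m.
Proof.
move=> s0 sr r1.
have A0 : (0 <= A s r)%E by apply: integral_ge0 => t _; rewrite lee_fin.
have L0 : 0 < ln r - ln s.
  by rewrite subr_gt0 ltr_ln ?posrE// (lt_trans s0).
have H c (c0 : 0 <= c) := increment_linear s0 sr c0.
have := energy_fin s0 sr r1; have := increment_fin s0 sr r1.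
move: A0 H; case: (A s r) => [a||]//; case: (E s r) => [e||]// a0 H _ _ /=.
rewrite lee_fin in a0.
set L := ln r - ln s in L0 H *.
(* The optimal [c]: then n c^m a - m c^n L equals a^n / L^m. *)
have := H (a / L) (divr_ge0 a0 (ltW L0)).
rewrite -EFinM -EFinD lee_fin !expr_div_n -ler_pdivrMr ?exprn_gt0//.
rewrite ![_ ^+ n]exprSr invfM.
have : L ^+ m != 0 by rewrite expf_neq0// gt_eqF.
have : L != 0 by rewrite gt_eqF.
rewrite -natr1; move: (L ^+ m) (a ^+ m) => x y L1 x0.
have -> : (m%:R + 1) * (y / x) * a = (m%:R * (y * a * (x^-1 / L)) * L) + y * a / x by field; rewrite L1 x0.
lra.
Qed.

Definition profile r := fine (A r 1).

Lemma profile_ge0 r : 0 <= profile r.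
Proof. by rewrite fine_ge0//; apply: integral_ge0 => t _; rewrite lee_fin. Qed.

Lemma profileE r : 0 < r < 1 -> A r 1 = (profile r)%:E.
Proof. by move=> /andP[r0 r1]; rewrite fineK// increment_fin. Qed.

Lemma profile_split s r : 0 < s -> s < r -> r < 1 ->
  profile s = profile r + fine (A s r).
Proof.
move=> s0 sr r1; have r0 := lt_trans s0 sr; rewrite /profile -fineD; last 2 first.
- exact: increment_fin.
- by apply: increment_fin => //; exact: ltW.
congr fine; rewrite /A addeC.
rewrite -[X in (_ + X)%E](integral_itv_bndoo true true); last exact: mfE.
rewrite -ge0_integral_setU//=; last 2 first.
- by move=> t _; rewrite lee_fin.
- apply/disj_setPS => t /= [] /=; rewrite !in_itv /= => /andP[_ h1] /andP[h2 _].
  by have := lt_le_trans h1 h2; rewrite ltxx.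
congr (integral _ _ _); apply/seteqP; split => t /=; rewrite !in_itv /=.
  move=> /andP[st t1]; have [tr|rt] := ltP t r; first by left; rewrite st.
  by right.
move=> [/andP[-> h]|/andP[h ->]] /=; first exact: lt_trans h r1.
by rewrite andbT (lt_le_trans sr).
Qed.

End profile.

(** * Level sets of the deficit *)

Section majorant.
Context {R : realType} {m : nat}.
Local Notation n := m.+1.
Local Notation leb := (@lebesgue_measure R).
Local Notation q := (n%:R / m%:R : R).
Local Notation K := (2 ^+ n * m%:R : R).
Local Notation L := (2 + 2 ^+ n.+1 * m%:R : R).
Hypothesis m0 : (0 < m)%N.

(* [log_interval rho l] is the interval of length [l] ending at [rho] in the
   variable [- n ln r]. *)
Definition log_interval (rho l : R) : set (measurableTypeR R) :=
  [set` `[rho * expR (- (l / n%:R)), rho]].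

Lemma integral_log_interval (rho l : R) : 0 < rho -> 0 <= l ->
  (\int[leb]_(r in log_interval rho l) (r^-1)%:E = (l / n%:R)%:E)%E.
Proof.
move=> rho0 l0; have ln0 : 0 <= l / n%:R by rewrite divr_ge0.
rewrite /log_interval integral_inv ?mulr_gt0 ?expR_gt0//.
  by rewrite lnM ?posrE ?expR_gt0// expRK opprD opprK addrA subrr add0r.
by rewrite ger_pMr// -[leRHS]expR0 ler_expR oppr_le0 divr_ge0.
Qed.

(** The covering interval ends at [sup P]. The supremum need not satisfy [P], so its distance to [r]
    is estimated by showing that [r * expR (l / n%:R)] is an upper bound of [P]. *)
Lemma level_sup (P : R -> Prop) (l : R) : 0 <= l ->
  (forall r, P r -> 0 < r < 1) ->
  (forall s r, s < r -> P s -> P r -> n%:R * (ln r - ln s) <= l) ->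
  exists2 rho, 0 < rho & forall r, P r -> log_interval rho l r.
Proof.
move=> l0 P01 Pl.
have [[r1 Pr1]|noP] := pselect (exists r, P r); last first.
  by exists 1 => // r Pr; exfalso; apply: noP; exists r.
have supP : has_sup P.
  by split; [exists r1|exists 1 => r /P01 /andP[_ /ltW]].
exists (sup P).
  have /andP[r10 _] := P01 _ Pr1; apply: (lt_le_trans r10).
  by apply: ub_le_sup => //; case: supP.
move=> r Pr; rewrite /log_interval /= in_itv /=; apply/andP; split; last first.
  by apply: ub_le_sup => //; case: supP.
have /andP[r0 _] := P01 _ Pr.
rewrite expRN ler_pdivrMr ?expR_gt0//; apply: ge_sup; first by exists r1.
move=> r' Pr'; have /andP[r'0 _] := P01 _ Pr'.
have lpos : 1 <= expR (l / n%:R) by rewrite -[leLHS]expR0 ler_expR divr_ge0.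
have [r'r|rr'] := leP r' r.
  by apply: (le_trans r'r); rewrite ler_peMr// ltW.
rewrite -[r' in leLHS]lnK ?posrE// -[r in leRHS]lnK ?posrE// -expRD ler_expR.
by rewrite -lerBlDl ler_pdivlMr// mulrC Pl.
Qed.

Variables (f : R -> R) (om a : R).
Hypothesis mf : measurable_fun setT (f : measurableTypeR R -> measurableTypeR R).
Hypothesis f0 : forall r, 0 <= f r.
Hypothesis om0 : 0 < om.
Hypothesis energy_le :
  (\int[leb]_(r in `]0%R, 1%R[) (f r ^+ n * r ^+ m)%:E <= (om^-1)%:E)%E.
Hypothesis a0 : 0 < a.
Hypothesis aE : a ^+ m = n%:R ^+ m * om.

Local Notation W := (profile f).
Local Notation T r := (- (n%:R * ln r)).

Let En s r := fine (\int[leb]_(t in `]s, r[) (f t ^+ n * t ^+ m)%:E)%E.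

Let T_gt0 (r : R) : 0 < r < 1 -> 0 < T r.
Proof. by move=> r01; rewrite oppr_gt0 pmulr_rlt0 // ln_lt0. Qed.

Let En_ge0 (s r : R) : 0 < s -> 0 <= En s r.
Proof.
move=> s0; apply: fine_ge0; apply: integral_ge0 => t.
rewrite /= in_itv /= => /andP[st _]; have t0 := ltW (lt_trans s0 st).
by rewrite lee_fin mulr_ge0// exprn_ge0.
Qed.

Let En_split s r : 0 < s -> s < r -> r < 1 -> om * En r 1 + om * En s r <= 1.
Proof.
move=> s0 sr r1; rewrite -mulrDr -ler_pdivlMl// mulr1 addrC.
rewrite -lee_fin EFinD /En !fineK; first exact: (energy_split mf f0 energy_le).
- by apply: (energy_fin mf f0 energy_le) => //; exact: lt_trans sr.
- by apply: (energy_fin mf f0 energy_le) => //; exact: ltW.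
Qed.

(** The critical value of [a] in [aE] makes Hoelder's inequality read this way, with [om * En r 1]
    the fraction of the admissible energy spent between [r] and 1. *)
Let W_power (r : R) : 0 < r < 1 -> a ^+ m * W r ^+ n <= om * En r 1 * T r ^+ m.
Proof.
move=> /andP[r0 r1].
have := increment_power mf f0 energy_le r0 r1 (lexx 1).
rewrite -/(W r) -/(En r 1) ln1 sub0r => H.
rewrite aE -[T r]mulrN exprMn.
rewrite [leRHS](_ : _ = n%:R ^+ m * om * (En r 1 * (- ln r) ^+ m)); last by ring.
by rewrite ler_wpM2l// mulr_ge0 ?exprn_ge0// ltW.
Qed.

Lemma profile_le (r : R) : 0 < r < 1 -> a * W r `^ q <= T r.
Proof.
move=> r01; have /andP[r0 r1] := r01.
rewrite -(@ler_pXn2r _ m)// ?nnegrE ?mulr_ge0 ?powR_ge0 ?(ltW a0)//; last exact/ltW/T_gt0.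
rewrite exprMn powR_exp_ratio// ?(profile_ge0 f0)//.
apply: (le_trans (W_power r01)); apply: ler_piMl.
  by rewrite exprn_ge0// ltW// T_gt0.
(* The point [r / 2] serves only to read [om * En r 1 <= 1] off [En_split]. *)
have r20 : 0 < r / 2 by rewrite divr_gt0.
have r2r : r / 2 < r by rewrite ltr_pdivrMr// ltr_pMr// ltr1n.
have := En_split r20 r2r r1; have : 0 <= om * En (r / 2) r.
  by rewrite mulr_ge0 ?En_ge0// ltW.
lra.
Qed.

(** [K] is the threshold and [L] the bound in [moser_pair]. Points with T < K lam fill the interval
    ending at 1; any two points of the level set beyond the threshold are within L lam of each
    other, so [level_sup] covers them. *)
Lemma level_set (lam : R) : 0 < lam -> exists2 rho, 0 < rho &
  forall r, 0 < r < 1 -> T r - lam <= a * W r `^ q ->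
    log_interval 1 (K * lam) r \/ log_interval rho (L * lam) r.
Proof.
move=> lam0.
have L0 : 0 <= L * lam.
  by rewrite mulr_ge0 ?(ltW lam0)// addr_ge0// mulr_ge0// exprn_ge0.
pose P r := [/\ 0 < r < 1, T r - lam <= a * W r `^ q & K * lam <= T r].
have [rho rho0 HP] : exists2 rho, 0 < rho & forall r, P r -> log_interval rho (L * lam) r.
  apply: level_sup => // [r []//|s r sr [s01 Hs _] [r01 Hr Kr]].
  have /andP[s0 _] := s01; have /andP[r0 r1] := r01.
  have lnsr : 0 <= ln r - ln s by rewrite subr_ge0 ler_ln ?posrE// ltW.
  have ln_s : T s = T r + n%:R * (ln r - ln s) by ring.
  have A0 : 0 <= fine (\int[leb]_(t in `]s, r[) (f t)%:E)%E.
    by apply: fine_ge0; apply: integral_ge0 => t _; rewrite lee_fin.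
  rewrite (profile_split mf f0 energy_le s0 sr r1) ln_s in Hs.
  apply: (@moser_pair R m a (W r) (fine (\int[leb]_(t in `]s, r[) (f t)%:E)%E)
    (T r) (n%:R * (ln r - ln s)) lam (om * En r 1) (om * En s r)).
  - exact: m0.
  - exact: a0.
  - exact: profile_ge0.
  - exact: A0.
  - exact: mulr_ge0.
  - exact: lam0.
  - by rewrite mulr_ge0 ?En_ge0// ltW.
  - by rewrite mulr_ge0 ?En_ge0// ltW.
  - exact: En_split.
  - exact: W_power.
  - have H := increment_power mf f0 energy_le s0 sr (ltW r1).
    rewrite aE exprMn.
    rewrite [leRHS](_ : _ = n%:R ^+ m * om * (En s r * (ln r - ln s) ^+ m)); last by ring.
    by rewrite ler_wpM2l// mulr_ge0 ?exprn_ge0// ltW.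
  - exact: Hr.
  - exact: Hs.
  - exact: Kr.
exists rho => // r r01 Hr.
have [KT|TK] := leP (K * lam) (T r); first by right; exact: HP.
left; have /andP[r0 r1] := r01.
rewrite /log_interval /= in_itv /= mul1r (ltW r1) andbT.
rewrite -[r in leRHS]lnK ?posrE// ler_expR lerNl ler_pdivlMr//.
by rewrite mulrC mulrN ltW.
Qed.

End majorant.

(** * A measurable majorant of the critical exponential *)

Section moser_majorant.
Context {R : realType} {m : nat}.
Local Notation n := m.+1.
Local Notation leb := (@lebesgue_measure R).
Local Notation q := (n%:R / m%:R : R).
Local Notation K := (2 ^+ n * m%:R : R).
Local Notation L := (2 + 2 ^+ n.+1 * m%:R : R).
Hypothesis m0 : (0 < m)%N.

Let I rho l := @log_interval R m rho l.

Lemma measurable_log_interval rho l : measurable (I rho l).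
Proof. exact: measurable_itv. Qed.

Lemma integral_indic_log_interval (rho l : R) : 0 < rho -> 0 <= l ->
  (\int[leb]_(r in `]0%R, 1%R[) (\1_(I rho l) r * r `^ (-1))%:E <= (l / n%:R)%:E)%E.
Proof.
move=> rho0 l0; have mI := measurable_log_interval rho l.
have mpow (D : set (measurableTypeR R)) : measurable_fun D (fun r : measurableTypeR R => (r `^ (-1))%:E).
  by apply/measurable_EFinP; apply: measurable_funTS; exact: measurable_powR.
rewrite (eq_integral ((fun r => (r `^ (-1))%:E) \_ (I rho l))); last first.
  move=> r _; rewrite patchE indicE; case: ifP => _; first by rewrite mul1r.
  by rewrite mul0r.
rewrite -integral_mkcondr -(integral_log_interval rho0 l0).
apply: (@le_trans _ _ (\int[leb]_(r in I rho l) (r `^ (-1))%:E)%E).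
  apply: ge0_subset_integral => //; first exact: measurableI.
  by move=> r _; rewrite lee_fin powR_ge0.
rewrite le_eqVlt; apply/orP; left; apply/eqP; apply: eq_integral => r.
rewrite inE /I /log_interval /= in_itv /= => /andP[h _].
by rewrite powR_inv1// (le_trans _ h)// mulr_ge0 ?(ltW rho0) ?expR_ge0.
Qed.

Lemma geometric_sum_le (c z : R) (N : nat) : 0 <= c -> 0 <= z < 1 ->
  \sum_(0 <= i < N) c * z ^+ i <= c / (1 - z).
Proof.
move=> c0 /andP[z0 z1]; rewrite -mulr_sumr ler_wpM2l// big_mkord.
have z1' : 0 < 1 - z by rewrite subr_gt0.
rewrite -[leRHS]mul1r ler_pdivlMr// mulrC.
have -> : (1 - z) * \sum_(i < N) z ^+ i = 1 - z ^+ N.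
  by rewrite -[RHS]opprB subrX1 -mulNr opprB.
by rewrite gerBl exprn_ge0.
Qed.

(** Half of the exponential decay absorbs the linear growth of the interval lengths: k + 1 <= 2 (1 +
    k/2) <= 2 e^(k/2). *)
Lemma exp_linear_le (k : nat) : expR (- k%:R) * k.+1%:R <= 2 * expR (- 2^-1) ^+ k :> R.
Proof.
have E (j : nat) (x : R) : expR x ^+ j = expR (j%:R * x).
  by rewrite expRM_natl.
rewrite E -natr1.
have -> : - k%:R = (k%:R * - 2^-1) - k%:R / 2 :> R by field.
rewrite expRD mulrAC expRN -mulrA [leRHS]mulrC ler_wpM2l ?expR_ge0//.
rewrite mulrC ler_pdivrMl ?expR_gt0//.
have := expR_ge1Dx (k%:R / 2 : R); lra.
Qed.

(** Sum of the geometric series bounding the layers: layer [k] contributes at most 2 (K + L)/n times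
    e^(-k/2). *)
Definition moser_constant : R := 2 * (K + L) / n%:R / (1 - expR (- 2^-1)).

(** [Phi] is e^T times a sum of indicators of intervals with weights e^(-k), so its measurability is
    plain. Against r^m dr the factor e^T = r^(-n) leaves dr/r, that is dT/n, which measures each
    interval by its length in T. *)
Lemma moser_majorant (f : R -> R) (om a : R) :
  measurable_fun setT (f : measurableTypeR R -> measurableTypeR R) ->
  (forall r, 0 <= f r) -> 0 < om ->
  (\int[leb]_(r in `]0%R, 1%R[) (f r ^+ n * r ^+ m)%:E <= (om^-1)%:E)%E ->
  0 < a -> a ^+ m = n%:R ^+ m * om ->
  exists Phi : R -> \bar R, [/\
    measurable_fun setT (Phi : measurableTypeR R -> \bar R),
    forall r, (0 <= Phi r)%E,
    (\int[leb]_(r in `]0%R, 1%R[) (Phi r * (r ^+ m)%:E) <= moser_constant%:E)%E &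
    forall r, 0 < r < 1 -> ((expR (a * profile f r `^ q))%:E <= Phi r)%E].
Proof.
move=> mf f0 om0 energy_le a0 aE.
have := choice (fun k : nat => _ : exists rho, 0 < rho /\
  forall r, 0 < r < 1 -> - (n%:R * ln r) - k.+1%:R <= a * profile f r `^ q ->
    I 1 (K * k.+1%:R) r \/ I rho (L * k.+1%:R) r).
case.
  move=> k.
  have [rho rho0 H] := level_set m0 mf f0 om0 energy_le a0 aE (ltr0Sn R k).
  by exists rho.
move=> rho Hrho; have rho0 k : 0 < rho k by have [] := Hrho k.
pose c1 k := I 1 (K * k.+1%:R); pose c2 k := I (rho k) (L * k.+1%:R).
pose term k r : R := expR (- k%:R) * (\1_(c1 k) r + \1_(c2 k) r).
have term0 k r : 0 <= term k r by rewrite mulr_ge0 ?expR_ge0// addr_ge0.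
pose S r := (\sum_(k <oo) (term k r)%:E)%E.
have S0 r : (0 <= S r)%E by apply: nneseries_ge0 => k _ _; rewrite lee_fin term0.
have mterm k (D : set (measurableTypeR R)) : measurable_fun D (term k : measurableTypeR R -> measurableTypeR R).
  apply: measurable_funTS; apply: measurable_funM => //.
  by apply: measurable_funD; apply: measurable_indic; exact: measurable_log_interval.
have mS : measurable_fun setT (S : measurableTypeR R -> \bar R).
  have := @ge0_emeasurable_sum _ (measurableTypeR R) R setT (fun k r => (term k r)%:E) xpredT.
  apply => [k r _ _|k _]; first by rewrite lee_fin term0.
  by apply/measurable_EFinP; exact: mterm.
have minv (D : set (measurableTypeR R)) :
    measurable_fun D (fun r : measurableTypeR R => r `^ (-1) : measurableTypeR R).
  by apply: measurable_funTS; exact: measurable_powR.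
have K0 : 0 <= K by rewrite mulr_ge0// exprn_ge0.
have L0 : 0 <= L by rewrite addr_ge0// mulr_ge0// exprn_ge0.
exists (fun r => ((r `^ (-1)) ^+ n)%:E * S r)%E; split.
- apply: emeasurable_funM => //; apply/measurable_EFinP.
  by apply: measurable_funX; exact: minv.
- by move=> r; rewrite mule_ge0// lee_fin exprn_ge0// powR_ge0.
- rewrite (eq_integral (fun r => \sum_(k <oo) (term k r * r `^ (-1))%:E))%E; last first.
    move=> r; rewrite inE /= in_itv /= => /andP[r0 _].
    rewrite muleAC -EFinM exprSr powR_inv1 ?(ltW r0)// mulrAC exprVn mulVf; last first.
      by rewrite expf_neq0// gt_eqF.
    rewrite mul1r /S -nneseriesZl; last by move=> k _; rewrite lee_fin term0.
    by apply: eq_eseriesr => k _; rewrite -EFinM mulrC.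
  rewrite integral_nneseries//; last 2 first.
  + move=> k; apply/measurable_EFinP; apply: measurable_funM; [exact: mterm|exact: minv].
  + by move=> k r _; rewrite lee_fin mulr_ge0// powR_ge0.
  have kbound k : (\int[leb]_(r in `]0%R, 1%R[) (term k r * r `^ (-1))%:E <=
      ((2 * (K + L) / n%:R) * expR (- 2^-1) ^+ k)%:E)%E.
    rewrite (eq_integral (fun r => (expR (- k%:R))%:E *
      ((\1_(c1 k) r * r `^ (-1))%:E + (\1_(c2 k) r * r `^ (-1))%:E)))%E; last first.
      by move=> r _; rewrite -EFinD -EFinM /term -mulrA mulrDl.
    have mi (c : set (measurableTypeR R)) (D : set (measurableTypeR R)) : measurable c ->
        measurable_fun D (fun r : measurableTypeR R => (\1_c r * r `^ (-1))%:E).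
      move=> mc; apply/measurable_EFinP; apply: measurable_funM; last exact: minv.
      exact: measurable_indic.
    have i0 (c : set (measurableTypeR R)) (r : R) : (0 <= (\1_c r * r `^ (-1))%:E)%E.
      by rewrite lee_fin mulr_ge0// powR_ge0.
    rewrite ge0_integralZl//; last 2 first.
    + by apply: emeasurable_funD; apply: mi; exact: measurable_log_interval.
    + by move=> r _; rewrite adde_ge0.
    rewrite ge0_integralD//; last 2 first.
    + by apply: mi; exact: measurable_log_interval.
    + by apply: mi; exact: measurable_log_interval.
    apply: (@le_trans _ _ ((expR (- k%:R))%:E *
      ((K * k.+1%:R / n%:R)%:E + (L * k.+1%:R / n%:R)%:E))%E).
      rewrite lee_wpmul2l ?lee_fin ?expR_ge0//; apply: leeD;
        by apply: integral_indic_log_interval => //; exact: mulr_ge0.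
    rewrite -EFinD -EFinM lee_fin -mulrDl -mulrDl.
    have := ler_wpM2l (divr_ge0 (addr_ge0 K0 L0) (ler0n R n)) (exp_linear_le k).
    move: (K + L) (expR _) (expR _ ^+ k) (n%:R^-1) => x y z w; lra.
  apply: lime_le.
    by apply: is_cvg_nneseries => k _ _; apply: integral_ge0 => r _;
      rewrite lee_fin mulr_ge0// powR_ge0.
  apply: nearW => N.
  apply: (@le_trans _ _ (\sum_(0 <= k < N) ((2 * (K + L) / n%:R) * expR (- 2^-1) ^+ k)%:E)%E).
    by apply: lee_sum => k _; exact: kbound.
  rewrite sumEFin lee_fin; apply: geometric_sum_le.
    by rewrite divr_ge0// mulr_ge0// addr_ge0.
  by rewrite expR_ge0 /= expR_lt1 oppr_lt0 invr_gt0.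
move=> r r01; have /andP[r0 r1] := r01.
have := profile_le m0 mf f0 om0 energy_le a0 aE r01.
set P := a * _; set T := - _ => PT.
have F0 : 0 <= T - P by rewrite subr_ge0.
(* The lower bound [k <= T - P] gives the factor e^(-k); the upper bound by k + 1 places [r] in the
   level set covered by [c1 k] and [c2 k]. This one term of the series already dominates. *)
pose k := Num.trunc (T - P).
have [kF Fk] : k%:R <= T - P /\ T - P <= k.+1%:R.
  by have /andP[h1 h2] := truncn_itv F0; split => //; exact: ltW.
have Tk : T - k.+1%:R <= P by rewrite lerBlDl -lerBlDr.
have one : 1 <= \1_(c1 k) r + \1_(c2 k) r :> R.
  have [h|h] := (Hrho k).2 r r01 Tk.
    by rewrite [X in X + _]indicE mem_set//= lerDl.
  by rewrite [X in _ + X]indicE mem_set//= lerDr.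
apply: (@le_trans _ _ (((r `^ (-1)) ^+ n)%:E * (term k r)%:E)%E); last first.
  rewrite lee_wpmul2l ?lee_fin ?exprn_ge0 ?powR_ge0//.
  apply: (@le_trans _ _ (\sum_(0 <= i < k.+1) (term i r)%:E)%E); last first.
    by apply: nneseries_lim_ge => i _ _; rewrite lee_fin term0.
  by rewrite big_nat_recr//= leeDr// sume_ge0// => i _; rewrite lee_fin term0.
rewrite -EFinM lee_fin powR_inv1 ?(ltW r0)//.
have ET : r^-1 ^+ n = expR T.
  by rewrite /T expRN expRM_natl lnK ?posrE// exprVn.
rewrite ET.
apply: (@le_trans _ _ (expR T * expR (- k%:R))).
  by rewrite -expRD ler_expR lerBrDl -lerBrDr.
by rewrite ler_wpM2l ?expR_ge0// /term -[leLHS]mulr1 ler_wpM2l ?expR_ge0.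
Qed.

End moser_majorant.

(** * Perturbed exponents and the main theorem *)

Section sup_bound.
Context {R : realType}.
Local Notation leb := (@lebesgue_measure R).

(** No measurability is asked for: the integral of a nonnegative function is a supremum over the
    simple functions below it. *)
Lemma le_integral_ge0 d (T : measurableType d) (mu : {measure set T -> \bar R})
    (D : set T) (f g : T -> \bar R) :
  (forall x, D x -> 0 <= f x)%E -> (forall x, D x -> f x <= g x)%E ->
  (\int[mu]_(x in D) f x <= \int[mu]_(x in D) g x)%E.
Proof.
move=> f0 fg; rewrite integral_mkcond [leRHS]integral_mkcond.
have fD x : (0 <= (f \_ D) x)%E.
  by rewrite patchE; case: ifPn => // /set_mem; exact: f0.
have fgD x : ((f \_ D) x <= (g \_ D) x)%E.
  by rewrite !patchE; case: ifPn => // /set_mem; exact: fg.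
rewrite !ge0_integralTE//; last by move=> x; exact: le_trans (fD x) (fgD x).
apply: le_ereal_sup => _ [h hf <-]; exists h => // x.
exact: le_trans (hf x) (fgD x).
Qed.

(** From 1 + y <= e^y at y = - al ln r. This is how the weight |x|^alpha absorbs the logarithmic
    growth at the origin. *)
Lemma powR_ln_le (al r : R) : 0 < al -> 0 < r -> r `^ al * (- ln r) <= al^-1.
Proof.
move=> al0 r0; rewrite -(ler_pM2l al0) divff ?gt_eqF// /powR gt_eqF//.
have := expR_ge1Dx (- (al * ln r)).
rewrite expRN -[X in _ <= X]mul1r ler_pdivlMr ?expR_gt0//.
have := expR_ge0 (al * ln r); move: (expR _) => e e0; nra.
Qed.

Lemma powR_sqr_ln_le (al r : R) : 0 < al -> 0 < r < 1 ->
  r `^ al * (- ln r) ^+ 2 <= (2 / al) ^+ 2.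
Proof.
move=> al0 /andP[r0 r1]; have al2 : 0 < al / 2 by rewrite divr_gt0.
have := powR_ln_le al2 r0; rewrite invf_div => H.
have -> : r `^ al = (r `^ (al / 2)) ^+ 2.
  rewrite expr2 -powRD; last by apply/implyP => _; rewrite gt_eqF.
  by congr (_ `^ _); field.
rewrite -exprMn ler_pXn2r// nnegrE.
  by rewrite mulr_ge0 ?powR_ge0// oppr_ge0 ln_le0// ltW.
by rewrite divr_ge0// ltW.
Qed.

(** The excess r^al w^q is at most r^al k (- ln r) / a, which [powR_ln_le] bounds. *)
Lemma perturbed_factor_le (al a q k r v w : R) : 0 < al -> 0 < a -> 0 <= q -> 0 <= k ->
  0 < r < 1 -> 0 <= v <= w -> a * w `^ q <= k * (- ln r) ->
  (a + r `^ al) * v `^ q <= a * w `^ q + k / (al * a).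
Proof.
move=> al0 a0 q0 k0 /andP[r0 r1] /andP[v0 vw] H.
have w0 := le_trans v0 vw.
apply: (@le_trans _ _ ((a + r `^ al) * w `^ q)).
  by rewrite ler_wpM2l ?addr_ge0 ?powR_ge0 ?(ltW a0)// ge0_ler_powR ?nnegrE.
rewrite mulrDl lerD2l.
apply: (@le_trans _ _ (r `^ al * (k * (- ln r) / a))).
  by rewrite ler_wpM2l ?powR_ge0// ler_pdivlMr// mulrC.
have := powR_ln_le al0 r0; rewrite invfM => /(ler_wpM2l (divr_ge0 k0 (ltW a0))).
move: (r `^ al) (ln r) (a^-1) (al^-1) => x y z t; lra.
Qed.

(** For v <= 1 the left side is at most [a]. Otherwise w > 1 and the additional factor is e^y with y
    = r^al ln w bounded, as ln w <= w^q. The excess is at most a constant times a w^q y, hence of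
    order r^al (ln r)^2, which explains the squared logarithm in [powR_sqr_ln_le]. *)
Lemma perturbed_exponent_le (al a q k r v w : R) : 0 < al -> 0 < a -> 1 <= q -> 0 <= k ->
  0 < r < 1 -> 0 <= v <= w -> a * w `^ q <= k * (- ln r) ->
  a * v `^ (q + r `^ al) <=
  a * w `^ q + (a + (k * (2 / al)) ^+ 2 * expR (k / (al * a)) / a).
Proof.
move=> al0 a0 q1 k0 r01 /andP[v0 vw] H; have /andP[r0 r1] := r01.
have w0 := le_trans v0 vw.
have q0 : 0 <= q by rewrite (le_trans ler01).
have p0 : 0 <= q + r `^ al by rewrite addr_ge0// powR_ge0.
have C0 : 0 <= (k * (2 / al)) ^+ 2 * expR (k / (al * a)) / a.
  by rewrite divr_ge0 ?(ltW a0)// mulr_ge0 ?expR_ge0// sqr_ge0.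
have aw0 : 0 <= a * w `^ q by rewrite mulr_ge0 ?powR_ge0// ltW.
have [v1|v1] := leP v 1.
  have : v `^ (q + r `^ al) <= 1.
    have := ge0_ler_powR p0 (_ : v \in Num.nneg) (_ : 1 \in Num.nneg) v1.
    by rewrite powR1; apply; rewrite nnegrE.
  by move=> /(ler_wpM2l (ltW a0)); lra.
have w1 : 1 < w by exact: lt_le_trans vw.
have wpos : 0 < w by rewrite (lt_trans ltr01).
apply: (@le_trans _ _ (a * w `^ (q + r `^ al))).
  by rewrite ler_wpM2l ?(ltW a0)// ge0_ler_powR ?nnegrE.
rewrite powRD; last by apply/implyP => _; rewrite gt_eqF.
rewrite [w `^ (r `^ al)]/powR gt_eqF//.
set e := r `^ al * ln w.
have lnw0 : 0 <= ln w by rewrite ln_ge0// ltW.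
have e0 : 0 <= e by rewrite mulr_ge0// powR_ge0.
have lnw : ln w <= k * (- ln r) / a.
  apply: (@le_trans _ _ (w `^ q)); last by rewrite ler_pdivlMr// mulrC.
  apply: (@le_trans _ _ (q * ln w)); first by rewrite ler_peMl.
  by rewrite /powR gt_eqF//; have := expR_ge1Dx (q * ln w); lra.
have ek : e <= r `^ al * (k * (- ln r) / a) by rewrite ler_wpM2l// powR_ge0.
have ec : e <= k / (al * a).
  apply: (le_trans ek).
  have := powR_ln_le al0 r0; rewrite invfM => /(ler_wpM2l (divr_ge0 k0 (ltW a0))).
  move: (r `^ al) (ln r) (a^-1) (al^-1) => x y z t; lra.
have expe : expR e <= 1 + e * expR (k / (al * a)).
  apply: (@le_trans _ _ (1 + e * expR e)).
    have := expR_ge1Dx (- e); rewrite expRN -[X in _ <= X]mul1r ler_pdivlMr ?expR_gt0//.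
    by lra.
  by rewrite lerD2l ler_wpM2l// ler_expR.
rewrite mulrA; apply: (le_trans (ler_wpM2l aw0 expe)).
rewrite mulrDr mulr1 lerD2l; apply: ler_wpDl; first exact: ltW.
rewrite mulrA [leRHS]mulrAC ler_wpM2r ?expR_ge0//.
apply: (le_trans (ler_pM aw0 e0 H ek)).
have ka0 : 0 <= k ^+ 2 / a by rewrite divr_ge0 ?sqr_ge0// ltW.
have := ler_wpM2l ka0 (powR_sqr_ln_le al0 r01).
move: (r `^ al) (ln r) (a^-1) (2 / al) => x y z t; lra.
Qed.

End sup_bound.

(** * Uniform bounds on the unit ball *)

Section main.
Context {R : realType} {m : nat}.
Local Notation n := m.+1.
Local Notation leb := (@lebesgue_measure R).
Local Notation lam := (lebesgue_rV R n).
Local Notation B := (@unit_ball R n).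
Local Notation q := (n%:R / m%:R : R).
Hypothesis m0 : (0 < m)%N.

Lemma natrS_sub1 : n%:R - 1 = m%:R :> R.
Proof. by rewrite -natr1 addrK. Qed.

Lemma alpha_crit_gt0 : 0 < alpha_crit R n.
Proof. by rewrite mulr_gt0 ?ltr0n// powR_gt0// omega_gt0. Qed.

Lemma alpha_crit_power : alpha_crit R n ^+ m = n%:R ^+ m * omega R n.
Proof.
rewrite /alpha_crit natrS_sub1 exprMn; congr (_ * _).
rewrite -powR_mulrn ?powR_ge0// -powRrM.
by rewrite div1r mulVf ?powRr1// ?(ltW omega_gt0)// pnatr_eq0 -lt0n.
Qed.

Local Open Scope ereal_scope.

(* The integrand need not be measurable here: it is only compared with a
   measurable majorant. *)
Lemma unit_energy_integral_le (psi : R -> R -> R) (c : R) :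
  (forall r v w, (0 < r < 1)%R -> (0 <= v <= w)%R ->
    (alpha_crit R n * w `^ q <= n%:R * (- ln r))%R ->
    (psi r v <= alpha_crit R n * w `^ q + c)%R) ->
  forall u, @unit_energy R n u ->
  \int[lam]_(x in B) (expR (psi (enorm x) `|u x|%R))%:E <=
  (expR c)%:E * ((omega R n)%:E * (@moser_constant R m)%:E).
Proof.
move=> psi_le u /radial_profile[f [mf f0 energy_le [N [mN N0 uN]]]].
have a0 := alpha_crit_gt0; have aE := alpha_crit_power.
have om0 : (0 < omega R n)%R := omega_gt0.
have [Phi [mPhi Phi0 IPhi Phi_ge]] := moser_majorant m0 mf f0 om0 energy_le a0 aE.
have mPhie : measurable_fun setT (fun x : 'rV[R]_n => Phi (enorm x)).
  exact: measurableT_comp mPhi measurable_enorm.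
pose g (x : 'rV[R]_n) : \bar R := (expR c)%:E * Phi (enorm x).
have g0 x : 0 <= g x by rewrite mule_ge0// lee_fin expR_ge0.
have mg : measurable_fun setT g by exact: emeasurable_funM.
(* The value +oo on [N], where nothing is known about [u], makes the comparison hold at every point
   of the ball without changing the integral. *)
pose h x := g x + ((cst +oo) \_ N) x.
have mB : measurable B by exact: measurable_unit_ball.
have moo : measurable_fun setT ((cst +oo : 'rV[R]_n -> \bar R) \_ N).
  exact: ((measurable_restrictT (cst +oo) mN).1 (measurable_cst _)).
have oo0 x : 0 <= ((cst +oo : 'rV[R]_n -> \bar R) \_ N) x.
  by rewrite patchE; case: ifP => _; [exact: le0y|exact: lexx].
apply: (@le_trans _ _ (\int[lam]_(x in B) h x)).
  apply: le_integral_ge0 => x Bx; first by rewrite lee_fin expR_ge0.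
  have [Nx|Nx] := pselect (N x).
    rewrite /h patchE mem_set// addey ?leey// gt_eqF// (lt_le_trans ltNy0)//.
  have [x0 ule] := uN x Bx Nx.
  have x01 : (0 < enorm x < 1)%R by rewrite x0.
  rewrite (profileE mf f0 energy_le x01) lee_fin in ule.
  rewrite /h patchE memNset// adde0 /g.
  apply: (@le_trans _ _ ((expR c)%:E * (expR (alpha_crit R n * profile f (enorm x) `^ q))%:E)); last first.
    by rewrite lee_wpmul2l ?lee_fin ?expR_ge0// Phi_ge.
  rewrite -EFinM lee_fin -expRD ler_expR addrC; apply: psi_le => //.
    by rewrite normr_ge0.
  by rewrite mulrN; exact: (profile_le m0 mf f0 om0 energy_le a0 aE).
rewrite (@ge0_ae_eq_integral _ _ _ _ _ h g)//; last 4 first.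
- by apply: measurable_funTS; exact: emeasurable_funD.
- exact: measurable_funTS.
- by move=> x _; exact: adde_ge0.
- exists N; split => // x /= hx; apply: contrapT => Nx; apply: hx => _.
  by rewrite /h patchE memNset// adde0.
rewrite ge0_integralZl//; last exact: measurable_funTS.
rewrite lee_wpmul2l ?lee_fin ?expR_ge0// radial_integral//.
by rewrite lee_wpmul2l// lee_fin ltW.
Qed.

End main.

Theorem theorem1p1 (R : realType) (alpha : R) (n : nat) :
  0 < alpha -> (2 <= n)%N ->
  (ereal_sup [set \int[lebesgue_rV R n]_(x in @unit_ball R n)
      (expR ((alpha_crit R n + enorm x `^ alpha) *
             `|u x| `^ (n%:R / (n%:R - 1))))%:E | u in @unit_energy R n]
    < +oo)%E /\
  (ereal_sup [set \int[lebesgue_rV R n]_(x in @unit_ball R n)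
      (expR (alpha_crit R n *
             `|u x| `^ (n%:R / (n%:R - 1) + enorm x `^ alpha)))%:E
      | u in @unit_energy R n]
    < +oo)%E.
Proof.
move=> alpha0; case: n => [//|m] m0; rewrite natrS_sub1.
have mR : 0 < m%:R :> R by rewrite ltr0n.
have q1 : 1 <= m.+1%:R / m%:R :> R by rewrite ler_pdivlMr// mul1r ler_nat.
have q0 : 0 <= m.+1%:R / m%:R :> R by rewrite (le_trans ler01).
have a0 := @alpha_crit_gt0 R m.
have sup_lt (J : ('rV[R]_m.+1 -> R) -> \bar R) (c : R) :
    (forall u, @unit_energy R m.+1 u -> J u <= c%:E)%E ->
    (ereal_sup [set J u | u in @unit_energy R m.+1] < +oo)%E.
  move=> Jc; apply: (@le_lt_trans _ _ c%:E); last by rewrite ltry.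
  by apply: ge_ereal_sup => _ [u hu <-]; exact: Jc.
split.
- apply: sup_lt => u hu.
  apply: (unit_energy_integral_le m0 (psi := fun r v =>
    (alpha_crit R m.+1 + r `^ alpha) * v `^ (m.+1%:R / m%:R)) _ hu) => r v w r01 vw H.
  by apply: (perturbed_factor_le (k := m.+1%:R)).
- apply: sup_lt => u hu.
  apply: (unit_energy_integral_le m0 (psi := fun r v =>
    alpha_crit R m.+1 * v `^ (m.+1%:R / m%:R + r `^ alpha)) _ hu) => r v w r01 vw H.
  by apply: (perturbed_exponent_le (k := m.+1%:R)).
Qed.
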